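(* Let $n\geq 2$. If every $\sigma$-$n$-linked poset has property $\mathrm{K}_{n+1}$, then $\mathrm{MA}_{\omega_1}(\sigma\text{-}n\text{-linked})$ holds.
   Context: A poset is a partially ordered set. A subset $X$ of a poset $\mathcal{P}$ is $n$-linked (for $n\ge 2$) if every $n$-element subset of $X$ has a common lower bound in $\mathcal{P}$. $\mathcal{P}$ is $\sigma$-$n$-linked if it is a countable union of $n$-linked subsets. $\mathcal{P}$ has property $\mathrm{K}_n$ if every uncountable subset of $\mathcal{P}$ has an uncountable $n$-linked subset. For a property $\Phi$ of posets implying the countable chain condition, $\mathrm{MA}_{\omega_1}(\Phi)$ is the assertion that for every poset $\mathcal{P}$ with property $\Phi$ and every collection $\mathcal{X}$ of $\omega_1$ many dense subsets of $\mathcal{P}$ there is a filter $G\subseteq\mathcal{P}$ with $G\cap D\ne\emptyset$ for all $D\in\mathcal{X}$. Here dense means downward cofinal, and a filter is an upward closed subset any finitely many elements of which have a common lower bound in it. *)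

(* Defs.v *)
From HB Require Import structures.
From mathcomp Require Import all_boot all_order.
From mathcomp Require Import all_classical.

Set Implicit Arguments.
Unset Strict Implicit.
Unset Printing Implicit Defensive.

Import Order.TTheory.

Local Open Scope classical_set_scope.
Local Open Scope card_scope.
Local Open Scope order_scope.

(* Stronger elements are smaller: [lbound A] is the set of common lower bounds
   of A. An n-element subset has exactly n distinct elements. *)
Definition linked (n : nat) (d : Order.disp_t) (P : porderType d)
    (X : set P) : Prop :=
  forall A : set P, A `<=` X -> A #= `I_n -> lbound A !=set0.

Definition sigma_linked (n : nat) (d : Order.disp_t) (P : porderType d) : Prop :=
  exists F : nat -> set P,
    (forall i, linked n (F i)) /\ \bigcup_i F i = [set: P].

Definition property_K (n : nat) (d : Order.disp_t) (P : porderType d) : Prop :=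
  forall X : set P, ~ countable X ->
    exists Y : set P, [/\ Y `<=` X, ~ countable Y & linked n Y].

Definition downward_cofinal (d : Order.disp_t) (P : porderType d)
    (D : set P) : Prop :=
  forall p : P, exists2 q, D q & q <= p.

(* The case A = set0 makes G nonempty. *)
Definition poset_filter (d : Order.disp_t) (P : porderType d)
    (G : set P) : Prop :=
  (forall p q : P, G p -> p <= q -> G q) /\
  (forall A : set P, A `<=` G -> finite_set A -> (G `&` lbound A) !=set0).

(* W is order-isomorphic to the first uncountable ordinal: an uncountable
   well-order all of whose proper initial segments are countable. *)
Definition is_omega1 (d : Order.disp_t) (W : orderType d) : Prop :=
  [/\ wochoice.well_order (<=%O : rel W),
      ~ countable [set: W] &
      forall w : W, countable [set v : W | v < w]].

(* "omega_1 many" is read as "at most omega_1 many", so that families indexed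
   by omega_1, possibly with repetitions, are covered. The poset is nonempty,
   since the empty poset has a dense subset, set0, that no filter meets. *)
Definition MA_omega1 (Phi : forall d : Order.disp_t, porderType d -> Prop) :
    Prop :=
  forall (d : Order.disp_t) (P : porderType d), [set: P] !=set0 -> Phi d P ->
  forall (dW : Order.disp_t) (W : orderType dW), is_omega1 W ->
  forall X : set (set P), X #<= [set: W] ->
    (forall D, X D -> downward_cofinal D) ->
  exists2 G : set P, poset_filter G &
    forall D, X D -> (G `&` D) !=set0.

(* Main.v *)
Require Import Defs.
From mathcomp Require Import all_boot all_order.
From mathcomp Require Import finmap all_classical.
From HB Require Import structures.

(**
Fix n and suppose that every sigma-n-linked poset has property K_{n+1}; write
omega_1 for a well-order W as in [is_omega1]. The point of the proof is that
this hypothesis turns a sigma-n-linked poset into something locally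
sigma-centered, and that it also makes sigma-centered forcing easy.

The combinatorial core is [clique_free]. Suppose that the elements of an
uncountable set carry, for each j, a label from a countable set, and that a
relation r_j between j-th labels fails for every given pair once j is large.
Finite sets containing no (n+1)-clique of any r_j form a sigma-n-linked poset:
if n of them have no r_j-edge at all, their union contains no (n+1)-clique, by
the pigeonhole principle. So property K_{n+1} gives an uncountable subset in
which no r_j has an (n+1)-clique.

Suitable labels then yield the two classical cardinal inequalities. With
prefixes of functions as labels, an uncountable set of functions from nat to nat
has an uncountable subset whose tree of prefixes is n-branching, hence a bounded
one; so omega_1 functions are eventually dominated by a single one
([dominate_small]). With finite blocks of the members of a tower as labels,
cliques are antichains of finite sets; families without antichains of size n+1
are hit by n points, and a minimality argument brings this down to one point:
towers of length omega_1, and then all centered families of omega_1 sets, have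
pseudo-intersections ([pseudo_intersection]). As in Bell's theorem, this gives
Martin's axiom for sigma-centered preorders, in the form [centered_generic].

The step from sigma-n-linked to sigma-centered is [uncountable_centered]. Let K
be a hereditary property of finite subsets of omega_1 such that the union of n
members of K of the same colour, among countably many colours, is again in K.
Finite sets labelled so that every subset without (n+1)-cliques of distinct
labels is in K form a sigma-centered preorder: any number of conditions of the
same shape have an amalgam, in which the new labels are chosen so that a set
without (n+1)-cliques of labels is covered by the traces of at most n
conditions. A generic family gives an uncountable labelled set, and
[clique_free] thins it out so that no cliques are left; then all its finite
subsets are in K.

Now consider omega_1 elements of the sigma-n-linked poset. At each stage w in
omega_1, label injectively the countably many of them whose rank is at most w,
from one countable set of labels, in such a way that two stages agree at all but
finitely many elements of rank at most the smaller stage. Let K hold of the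
finite sets F of stages such that the elements that get the same label at some
stage of F have a lower bound. Then K satisfies the assumptions, and an
uncountable set of stages all of whose finite subsets are in K splits the
omega_1 elements into countably many centered pieces ([small_sigma_centered]).
These pieces, for a subfamily of the poset closed under the operations needed
for density arguments, allow [centered_generic] to produce a filter
([generic_filter]).
*)

Set Implicit Arguments.
Unset Strict Implicit.
Unset Printing Implicit Defensive.
Import Order.TTheory.
Local Open Scope classical_set_scope.

(** * Downsets, finite lists and linked pieces *)

(** The poset reflection of a preorder R: elements are identified when they generate
the same downset. It carries the hypothesis on posets over to preorders. *)
Definition downset (T : Type) (R : T -> T -> Prop) :=
  {U : set T | exists t, U = (fun x => R x t)}.

Section DownsetOrder.
Context (T : Type) (R : T -> T -> Prop).
HB.instance Definition _ := gen_eqMixin (downset R).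
HB.instance Definition _ := gen_choiceMixin (downset R).
Definition downset_le (U V : downset R) := `[< sval U `<=` sval V >].
Fact downset_le_refl : reflexive downset_le.
Proof. by move=> U; apply/asboolP. Qed.
Fact downset_le_anti : antisymmetric downset_le.
Proof.
move=> [U pU] [V pV] /andP[/asboolP /= UV /asboolP /= VU].
have eUV : U = V by apply/seteqP.
by move: pU; rewrite eUV => pU; congr exist; exact: Prop_irrelevance.
Qed.
Fact downset_le_trans : transitive downset_le.
Proof.
by move=> U V Z /asboolP VU /asboolP UZ; apply/asboolP; apply: subset_trans UZ.
Qed.
HB.instance Definition _ := Order.Le_isPOrder.Build Order.default_display (downset R)
  downset_le_refl downset_le_anti downset_le_trans.
End DownsetOrder.

Section CardinalTools.
Context (T : choiceType).
Local Open Scope card_scope.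

Lemma uniq_cardII (s : seq T) : uniq s -> [set` s] #= `I_(size s).
Proof.
move=> us; have -> : [set` s] = [set` [fset x in s]%fset].
  by apply/seteqP; split=> x /=; rewrite !inE.
by apply/card_eq_fsetP; rewrite card_fseq undup_id.
Qed.

Lemma cardII_uniq (A : set T) m : A #= `I_m ->
  exists s : seq T, [/\ uniq s, size s = m & A = [set` s]].
Proof.
move=> Am; have /finite_fsetP[X AX] : finite_set A by exists m.
move: Am; rewrite AX => /card_eq_fsetP Xm.
by exists X; split=> //; exact: fset_uniq.
Qed.

Lemma uniq_or_finite_set (B : set T) m :
  (exists s, [/\ uniq s, size s = m & [set` s] `<=` B]) \/
  (exists s : seq T, B = [set` s]).
Proof.
elim: m => [|m [[s [us sm sB]]|]]; [by left; exists [::]| |by right].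
have [sup|] := pselect (B `<=` [set` s]).
  by right; exists s; apply/seteqP.
move=> /existsNP[x /not_implyP[Bx xs]]; left; exists (x :: s); split.
- by rewrite /= us andbT; apply/negP.
- by rewrite /= sm.
- by move=> y /=; rewrite inE => /predU1P[->|/sB].
Qed.

Lemma extend_uniq (s u : seq T) (B : set T) :
  uniq s -> (size s <= size u)%N -> [set` s] `<=` B ->
  uniq u -> [set` u] `<=` B ->
  exists s', [/\ uniq s', size s' = size u, {subset s <= s'} & [set` s'] `<=` B].
Proof.
move=> us su sB uu uB.
pose v := s ++ [seq x <- u | x \notin s].
have uv : uniq v.
  rewrite cat_uniq us filter_uniq // andbT /=.
  by apply/hasPn => x; rewrite mem_filter => /andP[].
have uv' : (size u <= size v)%N.
  apply: uniq_leq_size => // x xu; rewrite mem_cat mem_filter xu andbT.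
  exact: orbN.
have vB : [set` v] `<=` B.
  move=> x /=; rewrite mem_cat mem_filter => /orP[/sB//|/andP[_ /uB]//].
exists (take (size u) v); split.
- exact: take_uniq.
- by rewrite size_takel.
- move=> x xs; rewrite /v take_cat ltnNge su /= mem_cat xs//.
- by move=> x /= /mem_take/vB.
Qed.

End CardinalTools.

Lemma countable_subset (T : Type) (A B : set T) : A `<=` B -> countable B -> countable A.
Proof. by move=> /subset_card_le; exact: sub_countable. Qed.

Lemma not_countable_fiber (V : choiceType) (U : choiceType) (S : set V) (f : V -> U) :
  ~ countable S -> countable (f @` S) ->
  exists u, ~ countable [set v | S v /\ f v = u].
Proof.
move=> Sn fS; apply: contrapT => /forallNP h; apply: Sn.
apply: (@countable_subset _ _ (\bigcup_(u in f @` S) [set v | S v /\ f v = u])).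
  by move=> v Sv; exists (f v); [exists v|].
by apply: bigcup_countable => // u _; apply: contrapT; exact: h.
Qed.

(** A piece with fewer than n elements is n-linked for trivial reasons, and its
elements need not have lower bounds; such a piece is cut into singletons. After
that, lists of length n with repetitions allowed have lower bounds too, because
a list with fewer than n values can be completed to n distinct elements of its
piece. *)
Lemma sigma_linked_pieces (n : nat) d (P : porderType d) : (0 < n)%N ->
  sigma_linked n P ->
  exists pc : P -> nat, forall (f : nat -> P) c,
    (forall i, (i < n)%N -> pc (f i) = c) ->
    exists p : P, forall i, (i < n)%N -> (p <= f i)%O.
Proof.
move=> n0 [F [Fl FT]].
have /choice[ix ixP] : forall p : P, exists i, F i p.
  move=> p; have : [set: P] p by [].
  by rewrite -FT => -[i _ Fp]; exists i.
have /choice[S SP] : forall c, exists o : option (seq P),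
    if o is Some s then F c = [set` s]
    else exists s, [/\ uniq s, size s = n & [set` s] `<=` F c].
  move=> c; have [[s ?]|[s ?]] := uniq_or_finite_set (F c) n.
    by exists None; exists s.
  by exists (Some s).
pose pc p := choice.pickle (ix p, if S (ix p) is Some s then (index p s).+1 else 0%N).
exists pc => f c fc.
have fE i : (i < n)%N -> pc (f i) = pc (f 0%N) by move=> ?; rewrite !fc.
pose j := ix (f 0%N).
have ixE i : (i < n)%N -> ix (f i) = j.
  by move=> /fE /(pcan_inj choice.pickleK)[].
have Ff i : (i < n)%N -> F j (f i) by move=> i_n; rewrite -(ixE i i_n).
case SE : (S j) (SP j) => [s|] => [FE|[u [uu un uF]]].
  exists (f 0%N) => i i_n; suff -> : f i = f 0%N by [].
  have /(pcan_inj choice.pickleK)[_] := fE i i_n.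
  rewrite ixE // -/j SE => -[eqi].
  have fs k : (k < n)%N -> f k \in s by move=> /Ff; rewrite FE.
  by rewrite -(nth_index (f 0%N) (fs i i_n)) eqi nth_index // fs.
pose s := undup (mkseq f n).
have sn : (size s <= size u)%N.
  by rewrite un (leq_trans (size_undup _)) // size_mkseq.
have sF : [set` s] `<=` F j.
  by move=> x /=; rewrite mem_undup => /mapP[i]; rewrite mem_iota => /= i_n ->; exact: Ff.
have [s' [us' ss' sub s'F]] := extend_uniq (undup_uniq _) sn sF uu uF.
have [p pP] := Fl j [set` s'] s'F (eq_rect _ (fun m => ([set` s'] #= `I_m)%card) (uniq_cardII us') _ (etrans ss' un)).
exists p => i i_n; apply: pP => /=; apply: sub.
by rewrite mem_undup; apply/mapP; exists i; rewrite ?mem_iota.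
Qed.

(** * From property K_{n+1} to clique-free subfamilies *)

Definition for_large (Q : nat -> Prop) := exists k, forall j, (k <= j)%N -> Q j.

Lemma for_largeI (Q1 Q2 : nat -> Prop) :
  for_large Q1 -> for_large Q2 -> for_large (fun j => Q1 j /\ Q2 j).
Proof.
move=> [k1 h1] [k2 h2]; exists (maxn k1 k2) => j; rewrite geq_max => /andP[j1 j2].
by split; [exact: h1|exact: h2].
Qed.

Lemma for_large_sub (Q1 Q2 : nat -> Prop) :
  (forall j, Q1 j -> Q2 j) -> for_large Q1 -> for_large Q2.
Proof. by move=> h [k hk]; exists k => j /hk/h. Qed.

Lemma for_large_seq (X : eqType) (s : seq X) (Q : X -> nat -> Prop) :
  (forall x, x \in s -> for_large (Q x)) ->
  for_large (fun j => forall x, x \in s -> Q x j).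
Proof.
elim: s => [|x s ih] h; first by exists 0%N.
have [] := @for_largeI _ _ (h x (mem_head _ _)) (ih _).
  by move=> y ys; apply: h; rewrite inE ys orbT.
move=> k hk; exists k => j /hk[Qx Qs] y; rewrite inE => /predU1P[->//|]; exact: Qs.
Qed.

Definition clique (V : Type) (r : V -> V -> Prop) (m : nat) (S : set V) :=
  exists c : nat -> V, (forall i, (i < m)%N -> S (c i)) /\
    (forall i j, (i < j)%N -> (j < m)%N -> r (c i) (c j)).

Lemma pigeonhole_nat m (a : nat -> nat) : (forall i, (i < m.+1)%N -> (a i < m)%N) ->
  exists i j, [/\ (i < j)%N, (j < m.+1)%N & a i = a j].
Proof.
move=> am; have /(uniqPn 0%N)[i [j [ij]]] : ~~ uniq (mkseq a m.+1).
  apply/negP => u; suff /(uniq_leq_size u) : {subset mkseq a m.+1 <= iota 0 m}.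
    by rewrite size_mkseq size_iota ltnn.
  by move=> x /mapP[i ii ->]; move: ii; rewrite !mem_iota /= !add0n => /am.
rewrite size_mkseq => jm; rewrite !nth_mkseq // ?(ltn_trans ij jm) // => e.
by exists i, j.
Qed.

Section Fragment.
Context (n : nat) (n_gt0 : (0 < n)%N).
Context (KH : forall (d : Order.disp_t) (P : porderType d),
  sigma_linked n P -> property_K n.+1 P).

(** The family F may repeat values: if uncountably many indices give the same
downset, they form Y by themselves; otherwise an (n+1)-linked set of downsets is
pulled back along a section of F. *)
Lemma property_K_preorder (T : Type) (R : T -> T -> Prop) (cls : T -> nat)
    (V : choiceType) (S : set V) (F : V -> T) :
  (forall t, R t t) -> (forall x y z, R x y -> R y z -> R x z) ->
  (forall (f : nat -> T) c, (forall i, (i < n)%N -> cls (f i) = c) ->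
     exists t, forall i, (i < n)%N -> R t (f i)) ->
  ~ countable S ->
  exists Y : set V, [/\ Y `<=` S, ~ countable Y &
    forall s : seq V, uniq s -> size s = n.+1 -> [set` s] `<=` Y ->
      exists t, forall v, v \in s -> R t (F v)].
Proof.
move=> Rr Rt lk Sn.
pose D t : downset R := exist _ (fun x => R x t) (ex_intro _ t erefl).
have /choice[rep repP] : forall U : downset R, exists t, sval U = (fun x => R x t).
  by move=> [U [t Ut]]; exists t.
have sD : sigma_linked n (downset R).
  exists (fun c => [set U | cls (rep U) = c]); split; last first.
    by apply/seteqP; split=> // U _; exists (cls (rep U)).
  move=> c A Ac /cardII_uniq[[|U0 s] [us sn AE]].
    by move: n_gt0; rewrite -sn.
  have [|t tP] := lk (fun i => rep (nth U0 (U0 :: s) i)) c.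
    by move=> i i_n; apply: Ac; rewrite AE /=; apply: mem_nth; rewrite sn.
  exists (D t) => U; rewrite AE => Us; apply/asboolP => x /= xt.
  rewrite repP; apply: (Rt _ t) => //.
  have := tP (index U (U0 :: s)); rewrite nth_index //; apply.
  by rewrite -sn index_mem.
have KD := KH sD.
have [cX|nX] := pselect (countable ((D \o F) @` S)).
  have [U nU] := not_countable_fiber Sn cX.
  exists [set v | S v /\ (D \o F) v = U]; split=> //; first by move=> v [].
  move=> s us ss sY; exists (rep U) => v /sY[_ DU].
  have : sval ((D \o F) v) (rep U) by rewrite DU repP.
  exact.
have [Z [ZX nZ lZ]] := KD _ nX.
have /choice[sg sgP] : forall U, exists v, Z U -> S v /\ D (F v) = U.
  move=> U; have [/ZX[v Sv <-]|nZU] := pselect (Z U); first by exists v.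
  have [v _] : S !=set0 by apply/set0P; apply/eqP => S0; apply: Sn; rewrite S0.
  by exists v.
exists (sg @` Z); split.
- by move=> _ [U ZU <-]; have [] := sgP U ZU.
- move=> cY; apply: nZ.
  apply: (@countable_subset _ _ ((D \o F) @` (sg @` Z))).
    by move=> U ZU; exists (sg U); [exists U|have [_] := sgP U ZU].
  by apply: sub_countable cY; exact: card_image_le.
move=> s us ss sY.
have sZ v : v \in s -> Z (D (F v)) /\ sg (D (F v)) = v.
  by move=> /sY[U ZU <-]; have [_ ->] := sgP U ZU.
have uDs : uniq (map (D \o F) s).
  rewrite map_inj_in_uniq // => v w vs ws /= e.
  by rewrite -(sZ v vs).2 e (sZ w ws).2.
have [||U UP] := lZ [set` map (D \o F) s].
- by move=> _ /= /mapP[v vs ->]; have [] := sZ v vs.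
- by have := uniq_cardII uDs; rewrite size_map ss.
exists (rep U) => v vs.
have /UP/asboolP : [set` map (D \o F) s] (D (F v)) by apply/mapP; exists v.
by move=> /(_ (rep U)); apply; rewrite repP.
Qed.

(** The preorder consists of the finite sets without (n+1)-cliques, larger sets
being stronger. The class of a set s records a number k such that no relation [r
j] with j >= k holds inside s, and all labels of index below k. The union of n
sets of the same class has no (n+1)-clique: for j >= k two vertices of it lie in
the same set, and for j < k the clique can be copied into the first set, which
has the same labels. *)
Lemma clique_free (V : choiceType) (S : set V) (L : countType)
    (lab : nat -> V -> L) (r : nat -> V -> V -> Prop) :
  ~ countable S ->
  (forall j u u' v v', lab j u = lab j u' -> lab j v = lab j v' ->
     r j u v -> r j u' v') ->
  (forall j v, ~ r j v v) ->
  (forall u v, S u -> S v -> for_large (fun j => ~ r j u v)) ->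
  exists Y : set V, [/\ Y `<=` S, ~ countable Y &
    forall j, ~ clique (r j) n.+1 Y].
Proof.
move=> Sn rlab rirr rev.
pose T := {s : seq V | [set` s] `<=` S /\ forall j, ~ clique (r j) n.+1 [set` s]}.
pose R (t t' : T) := {subset sval t' <= sval t}.
have /choice[F FP] : forall v, exists t : T, S v -> sval t = [:: v].
  move=> v; have [Sv|nSv] := pselect (S v).
    suff h : [set` [:: v]] `<=` S /\ forall j, ~ clique (r j) n.+1 [set` [:: v]].
      by exists (exist _ [:: v] h).
    split=> [w /=|j [c [cv cr]]]; first by rewrite inE => /eqP ->.
    have := cv 0%N isT; have := cv 1%N n_gt0; rewrite /= !inE => /eqP e1 /eqP e0.
    by have := cr 0%N 1%N isT n_gt0; rewrite e0 e1; exact: rirr.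
  have h : [set` ([::] : seq V)] `<=` S /\ forall j, ~ clique (r j) n.+1 [set` ([::] : seq V)].
    by split=> // j [c [/(_ 0%N isT)]].
  by exists (exist _ [::] h).
have /choice[k kP] : forall t : T, exists k, forall j, (k <= j)%N ->
    forall u v, u \in sval t -> v \in sval t -> ~ r j u v.
  move=> [s [sS _]] /=.
  have [|k kP] := @for_large_seq _ s (fun u j => forall v, v \in s -> ~ r j u v).
    by move=> u us; apply: for_large_seq => v vs; apply: rev; exact: sS.
  by exists k => j /kP h u v us; exact: h.
pose cls t := choice.pickle (k t, [seq [seq lab j v | v <- sval t] | j <- iota 0 (k t)]).
have [||f c fc|Y [YS nY lY]] := @property_K_preorder T R cls V S F _ _ _ Sn.
- by move=> t v vt.
- by move=> x y z xy yz v /yz/xy.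
- have /= fE i : (i < n)%N -> cls (f i) = cls (f 0%N) by move=> ?; rewrite !fc.
  have kE i : (i < n)%N -> k (f i) = k (f 0%N) by move=> /fE/(pcan_inj choice.pickleK)[].
  have labE i j : (i < n)%N -> (j < k (f 0%N))%N ->
      [seq lab j v | v <- sval (f i)] = [seq lab j v | v <- sval (f 0%N)].
    move=> i_n jk; have /(pcan_inj choice.pickleK)[_] := fE i i_n.
    rewrite (kE i i_n) => /(congr1 (fun x => nth [::] x j)).
    by rewrite !(nth_map 0%N) ?size_iota // nth_iota.
  pose s := flatten [seq sval (f i) | i <- iota 0 n].
  have sP v : v \in s -> exists2 i, (i < n)%N & v \in sval (f i).
    by move=> /flatten_mapP[i]; rewrite mem_iota => /= i_n vi; exists i.
  suff h : [set` s] `<=` S /\ forall j, ~ clique (r j) n.+1 [set` s].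
    exists (exist _ s h) => i i_n v vi /=.
    by apply/flatten_mapP; exists i; rewrite ?mem_iota.
  split; first by move=> v /sP[i _ vi]; exact: (svalP (f i)).1.
  move=> j [d [ds dr]].
  have /choice[a aP] : forall i, exists a, (i < n.+1)%N -> (a < n)%N /\ d i \in sval (f a).
    move=> i; have [i_n|_] := ltnP i n.+1; last by exists 0%N.
    by have [a] := sP _ (ds i i_n); exists a.
  have [jk|kj] := ltnP j (k (f 0%N)); last first.
    (* Above k each of the n lists contributes at most one vertex. *)
    have [|i [i' [ii' i'n e]]] := @pigeonhole_nat n a; first by move=> i /aP[].
    have [a_n di] := aP i (ltn_trans ii' i'n).
    have [_ di'] := aP i' i'n.
    by apply: (kP (f (a i)) j _ _ _ _ _ (dr i i' ii' i'n)); rewrite ?kE // e.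
  have /choice[d' d'P] : forall i, exists v, (i < n.+1)%N -> v \in sval (f 0%N) /\ lab j (d i) = lab j v.
    move=> i; have [i_n|_] := ltnP i n.+1; last by exists (d 0%N).
    have [a_n di] := aP i i_n.
    have : lab j (d i) \in [seq lab j v | v <- sval (f 0%N)].
      by rewrite -(labE _ _ a_n jk) map_f.
    by move=> /mapP[v v0 e]; exists v.
  apply: ((svalP (f 0%N)).2 j); exists d'; split=> [i /d'P[]//|i i' ii' i'n].
  have [_ e] := d'P i (ltn_trans ii' i'n); have [_ e'] := d'P i' i'n.
  exact: rlab e e' (dr i i' ii' i'n).
exists Y; split=> // j [d [dY dr]].
have us : uniq (mkseq d n.+1).
  apply: contrapT => /negP/(uniqPn (d 0%N))[i [i' [ii']]].
  rewrite size_mkseq => i'n; rewrite !nth_mkseq // ?(ltn_trans ii' i'n) // => e.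
  by have := dr i i' ii' i'n; rewrite e; exact: rirr.
have [||t tP] := lY _ us; first by rewrite size_mkseq.
  by move=> x /= /mapP[i ii ->]; apply: dY; move: ii; rewrite mem_iota.
apply: ((svalP t).2 j); exists d; split=> // i i_n /=.
have : d i \in mkseq d n.+1 by apply/mapP; exists i; rewrite ?mem_iota.
by move=> /tP; apply; rewrite FP ?inE //; apply: YS; exact: dY.
Qed.
End Fragment.

Section Bounding.
Context (n : nat) (n_gt0 : (0 < n)%N).
Context (KH : forall (d : Order.disp_t) (P : porderType d),
  sigma_linked n P -> property_K n.+1 P).

Lemma mkseq_eq (f g : nat -> nat) m :
  mkseq f m = mkseq g m <-> forall i, (i < m)%N -> f i = g i.
Proof.
split=> [e i i_m|e].
  by have := congr1 (fun s => nth 0%N s i) e; rewrite !nth_mkseq.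
by apply/eq_in_map => i; rewrite mem_iota => /e.
Qed.

(** Apply [clique_free] to the relation of branching exactly at j, which is decided
by prefixes of length j+1. A clique consists of values at j with a common
prefix, so that the tree of prefixes of the members of Y is n-branching, and its
levels are finite. *)
Lemma bounded_subfamily (V : choiceType) (S : set V) (f : V -> nat -> nat) :
  ~ countable S ->
  exists (Y : set V) (g : nat -> nat), [/\ Y `<=` S, ~ countable Y &
    forall v, Y v -> forall j, (f v j <= g j)%N].
Proof.
move=> Sn.
pose r j u v := mkseq (f u) j = mkseq (f v) j /\ f u j <> f v j.
have [|||Y [YS nY cY]] := clique_free n_gt0 KH
    (lab := fun j v => mkseq (f v) j.+1) (r := r) Sn.
- move=> j u u' v v' /mkseq_eq eu /mkseq_eq ev [/mkseq_eq e d]; split.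
    by apply/mkseq_eq => i ij; rewrite -eu ?(ltn_trans ij) // -ev ?(ltn_trans ij) // e.
  by rewrite -eu // -ev.
- by move=> j v [].
- move=> u v _ _; have [e|] := pselect (forall i, f u i = f v i).
    by exists 0%N => j _ [_]; rewrite e.
  by move=> /existsNP[i d]; exists i.+1 => j ij [/mkseq_eq e _]; apply: d; exact: e.
have fin j : exists s : seq (seq nat), forall v, Y v -> mkseq (f v) j \in s.
  elim: j => [|j [s sP]]; first by exists [:: [::]].
  have /choice[val valP] : forall p : seq nat, exists l : seq nat,
      forall v, Y v -> mkseq (f v) j = p -> f v j \in l.
    move=> p; pose B := [set f v j | v in [set v | Y v /\ mkseq (f v) j = p]].
    have [[l [ul sl lB]]|[l lE]] := uniq_or_finite_set B n.+1; last first.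
      by exists l => v Yv vp; have : B (f v j); [exists v|rewrite lE].
    exfalso; apply: (cY j).
    have /choice[c cP] : forall i, exists v, (i < n.+1)%N ->
        [/\ Y v, mkseq (f v) j = p & f v j = nth 0%N l i].
      move=> i; have [i_n|_] := ltnP i n.+1; last first.
        have [v] : Y !=set0 by apply/set0P; apply/eqP => Y0; apply: nY; rewrite Y0.
        by exists v.
      have [|v [Yv vp] e] := lB (nth 0%N l i); first by rewrite /= mem_nth ?sl.
      by exists v.
    exists c; split=> [i /cP[]//|i i' ii' i'n].
    have [_ e1 e2] := cP i (ltn_trans ii' i'n); have [_ e1' e2'] := cP i' i'n.
    split; first by rewrite e1 e1'.
    rewrite e2 e2' => /eqP; rewrite nth_uniq ?sl // ?(ltn_trans ii') //.
    by rewrite ltn_eqF.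
  exists [seq rcons p a | p <- s, a <- val p] => v Yv.
  rewrite /mkseq -addn1 iotaD map_cat /= cats1; apply/allpairsPdep.
  by exists (mkseq (f v) j), (f v j); split; [exact: sP|exact: valP|].
have /choice[s sP] := fin.
exists Y, (fun j => \max_(p <- s j.+1) last 0 p)%N; split=> // v Yv j.
have := @leq_bigmax_seq _ _ xpredT (last 0%N) _ (sP j.+1 v Yv) isT.
apply: leq_trans.
by rewrite /mkseq -addn1 iotaD map_cat /= cats1 last_rcons.
Qed.
End Bounding.

(** * Recursion along omega_1 *)

Section OmegaOne.
Context (dW : Order.disp_t) (W : orderType dW) (W1 : is_omega1 W).
Local Open Scope order_scope.

Lemma omega1_ind (Q : W -> Prop) : (forall w, (forall v, v < w -> Q v) -> Q w) ->
  forall w, Q w.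
Proof.
move=> ih w; apply: contrapT => nQ; have [wo _ _] := W1.
have [|z [[]]] := wo [pred v | `[< ~ Q v >]].
  by exists w; rewrite inE.
rewrite inE => nz zm _; apply: nz; apply: ih => v vz.
apply: contrapT => nv; have /zm : v \in [pred v | `[< ~ Q v >]] by rewrite inE.
by rewrite leNgt vz.
Qed.

Lemma omega1_wf : well_founded (fun v w : W => v < w).
Proof. by apply: omega1_ind => w ih; constructor. Qed.

(** Transfinite recursion where the next value is chosen, and where it may be
assumed that the values chosen so far satisfy the requirement Phi. Phi w g t
reads g only below w, which is the locality assumption. *)
Lemma wf_choice (T : Type) (Phi : W -> (W -> T) -> T -> Prop) :
  (forall w g g' t, (forall v, v < w -> g v = g' v) -> Phi w g t -> Phi w g' t) ->
  (forall w g, (forall v, v < w -> Phi v g (g v)) -> exists t, Phi w g t) ->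
  inhabited T ->
  exists g, forall w, Phi w g (g w).
Proof.
move=> loc step [t0].
pose ext (w : W) (rec : forall v : W, v < w -> T) (v : W) :=
  if pselect (v < w) is left h then rec v h else t0.
have /choice[pick pickP] : forall p : W * (W -> T), exists t,
    (exists t', Phi p.1 p.2 t') -> Phi p.1 p.2 t.
  by move=> [w g]; have [[t ?]|?] := pselect (exists t', Phi w g t'); [exists t|exists t0].
pose F (w : W) (rec : forall v : W, v < w -> T) := pick (w, ext w rec).
pose g := Fix omega1_wf (fun=> T) F.
have gE w : g w = F w (fun v _ => g v).
  rewrite /g Fix_eq // => x f f' ff'; congr F.
  by apply: functional_extensionality_dep => y; apply: functional_extensionality_dep.
exists g; apply: omega1_ind => w ih.
have agree v : v < w -> g v = ext w (fun v _ => g v) v.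
  by rewrite /ext; case: pselect.
apply: (loc _ _ _ _ (fun v vw => esym (agree v vw))).
rewrite gE; apply: (pickP (w, ext w (fun v _ => g v))) => /=.
have [t tP] := step w g ih; exists t; exact: loc agree tP.
Qed.
End OmegaOne.

(** * Sets of cardinality at most omega_1 *)

Lemma countable_code (T : Type) (A : set T) : countable A ->
  exists f : T -> nat, forall x y, A x -> A y -> f x = f y -> x = y.
Proof.
move=> /countable_injP[f fi]; exists f => x y Ax Ay; apply: fi; exact/mem_set.
Qed.

Lemma code_countable (T : Type) (A : set T) (f : T -> nat) :
  (forall x y, A x -> A y -> f x = f y -> x = y) -> countable A.
Proof.
by move=> fi; apply/countable_injP; exists f => x y /set_mem Ax /set_mem Ay; exact: fi.
Qed.

Lemma countable_enum (T : Type) (A : set T) (x0 : T) : countable A -> A x0 ->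
  exists e : nat -> T, (forall i, A (e i)) /\ forall x, A x -> exists i, e i = x.
Proof.
move=> /countable_code[f fi] A0.
have /choice[e eP] : forall i, exists x, A x /\ ((exists y, A y /\ f y = i) -> f x = i).
  move=> i; have [[y [Ay fy]]|h] := pselect (exists y, A y /\ f y = i).
    by exists y.
  by exists x0; split.
exists e; split=> [i|x Ax]; first by case: (eP i).
have [Ae fe] := eP (f x); exists (f x); apply: fi => //; apply: fe; by exists x.
Qed.

Lemma countable_preimage (T U : Type) (A : set T) (B : set U) (f : T -> U) :
  (forall x, A x -> B (f x)) -> (forall x y, A x -> A y -> f x = f y -> x = y) ->
  countable B -> countable A.
Proof.
move=> AB fi /countable_code[g gi]; apply: (@code_countable _ _ (g \o f)).
by move=> x y Ax Ay /= /gi e; apply: fi => //; apply: e; exact: AB.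
Qed.

Lemma countable_setU (T : Type) (A B : set T) :
  countable A -> countable B -> countable (A `|` B).
Proof.
move=> cA cB; apply: (@countable_subset _ _ (\bigcup_(b in [set: bool]) if b then A else B)).
  by move=> x [Ax|Bx]; [exists true|exists false].
by apply: bigcup_countable => [|[] _]; first exact: countableP.
Qed.

Lemma countable_seqs (T : eqType) (A : set T) : countable A ->
  countable [set s : seq T | forall x, x \in s -> A x].
Proof.
move=> /countable_code[f fi]; apply: (@code_countable _ _ (fun s => choice.pickle (map f s))).
move=> s t + + /(pcan_inj choice.pickleK).
elim: s t => [|x s ih] [|y t] //= sA tA [xy st].
rewrite (fi x y) //; [|by apply: sA; rewrite inE eqxx|by apply: tA; rewrite inE eqxx].
by rewrite (ih t) // => z zs; [apply: sA|apply: tA]; rewrite inE zs orbT.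
Qed.

Lemma dominate_countable (C : set (nat -> nat)) : countable C ->
  exists g, forall f, C f -> for_large (fun i => f i <= g i)%N.
Proof.
move=> cC; have [[f0 C0]|h] := pselect (exists f, C f); last first.
  by exists id => f Cf; case: h; exists f.
have [e [eC Ce]] := countable_enum cC C0.
exists (fun i => \max_(k < i.+1) e k i)%N => f /Ce[k <-]; exists k => i ki.
exact: (@leq_bigmax _ (fun k : 'I_i.+1 => e k i) (Ordinal (ki : k < i.+1)%N)).
Qed.

Section Small.
Context (dW : Order.disp_t) (W : orderType dW) (W1 : is_omega1 W).
Local Open Scope order_scope.

Lemma countable_le (w : W) : countable [set v : W | v <= w].
Proof.
have [_ _ cw] := W1; apply: (@countable_subset _ _ ([set v | v < w] `|` [set w])).
  by move=> v /=; rewrite le_eqVlt => /orP[/eqP->|?]; [right|left].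
exact: countable_setU.
Qed.

Lemma uncountable_unbounded (Y : set W) : ~ countable Y -> forall w, exists2 y, Y y & w < y.
Proof.
move=> nY w; apply: contrapT => h; apply: nY; apply: countable_subset (countable_le w).
by move=> y Yy /=; rewrite leNgt; apply/negP => wy; apply: h; exists y.
Qed.

Lemma unbounded_uncountable (Y : set W) : (forall w, exists2 y, Y y & w < y) -> ~ countable Y.
Proof.
move=> h cY; have [_ nW _] := W1; apply: nW.
apply: (@countable_subset _ _ (\bigcup_(y in Y) [set v | v <= y])).
  by move=> w _; have [y Yy wy] := h w; exists y => //=; exact: ltW.
by apply: bigcup_countable => // y _; exact: countable_le.
Qed.

Lemma omega1_inhabited : exists w : W, True.
Proof.
have [_ nW _] := W1; apply: contrapT => h; apply: nW.
by rewrite (_ : setT = set0) //; apply/seteqP; split=> // w _; apply: h; exists w.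
Qed.

(** Cardinality at most omega_1, in the form in which recursions along W use it:
countably many elements are handled at each stage. *)
Definition small (J : Type) :=
  exists rk : J -> W, forall w, countable [set j | rk j <= w].

Lemma small_W : small W.
Proof. by exists id; exact: countable_le. Qed.

Lemma small_inj (J J' : Type) (f : J -> J') : injective f -> small J' -> small J.
Proof.
move=> fi [rk rkP]; exists (rk \o f) => w; apply: (@countable_preimage _ _ _ _ f) (rkP w) => //.
by move=> x y _ _; exact: fi.
Qed.

Lemma small_prod (J J' : Type) : small J -> small J' -> small (J * J').
Proof.
move=> [rk rkP] [rk' rkP']; exists (fun p => Order.max (rk p.1) (rk' p.2)) => w.
apply: countable_subset (countableX (rkP w) (rkP' w)) => -[j j'] /=.
by rewrite ge_max => /andP[].
Qed.

Lemma small_nat : small nat.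
Proof. by have [w _] := omega1_inhabited; exists (fun=> w). Qed.

Lemma small_sum (J J' : Type) : small J -> small J' -> small (J + J').
Proof.
move=> [rk rkP] [rk' rkP'].
exists (fun p => match p with inl j => rk j | inr j => rk' j end) => w.
apply: (@countable_subset _ _ ((inl @` [set j | rk j <= w]) `|` (inr @` [set j | rk' j <= w]))).
  by move=> [j|j] /= jw; [left|right]; exists j.
apply: countable_setU.
- exact: sub_countable (card_image_le _ _) (rkP w).
- exact: sub_countable (card_image_le _ _) (rkP' w).
Qed.

Lemma small_seq (J : eqType) : small J -> small (seq J).
Proof.
move=> [rk rkP]; have [w0 _] := omega1_inhabited.
exists (fun s => \big[Order.max/w0]_(j <- s) rk j) => w.
apply: countable_subset (countable_seqs (rkP w)) => s /=.
elim: s => [//|x s ih]; rewrite big_cons ge_max => /andP[xw sw] y.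
by rewrite inE => /predU1P[->//|]; exact: ih.
Qed.

Lemma small_tree (J : eqType) : small J -> small (GenTree.tree J).
Proof.
move=> sJ; apply: (small_inj (pcan_inj (GenTree.codeK J))).
exact: small_seq (small_sum small_nat sJ).
Qed.
End Small.

(** * Dominating functions and pseudo-intersections *)

Section Towers.
Context (n : nat) (n_gt0 : (0 < n)%N).
Context (KH : forall (d : Order.disp_t) (P : porderType d),
  sigma_linked n P -> property_K n.+1 P).
Context (dW : Order.disp_t) (W : orderType dW) (W1 : is_omega1 W).
Local Open Scope order_scope.

(** First build a sequence h of length omega_1, increasing modulo finite sets, of
functions that dominate the given ones. A bound of uncountably many members of h
dominates all of h, since uncountable sets of indices are cofinal. *)
Lemma dominate_small (J : Type) (f : J -> nat -> nat) : small W J ->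
  exists g, forall j, for_large (fun i => f j i <= g i)%N.
Proof.
move=> [rk rkP].
pose Phi (w : W) (h : W -> nat -> nat) (t : nat -> nat) :=
  (forall v, v < w -> for_large (fun i => h v i <= t i)%N) /\
  (forall j, rk j <= w -> for_large (fun i => f j i <= t i)%N).
have [|||h hP] := @wf_choice _ _ W1 _ Phi; last 1 first.
- have [_ nW _] := W1.
  have [Y [g [_ nY gY]]] := bounded_subfamily n_gt0 KH h nW.
  exists g => j; have [y Yy jy] := uncountable_unbounded W1 nY (rk j).
  have [k kP] := (hP y).2 j (ltW jy); exists k => i /kP/leq_trans; apply; exact: gY.
- by move=> w h h' t hh' [h1 h2]; split=> // v vw; rewrite -hh' //; exact: h1.
- move=> w h _.
  have [|g gP] := @dominate_countable ((h @` [set v | v <= w]) `|` (f @` [set j | rk j <= w])).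
    apply: countable_setU; first exact: sub_countable (card_image_le _ _) (countable_le W1 w).
    exact: sub_countable (card_image_le _ _) (rkP w).
  exists g; split=> [v vw|j jw]; apply: gP; [left|right]; last by exists j.
  by exists v => //=; exact: ltW.
- exact: (inhabits id).
Qed.

Definition incomparable (x y : seq nat) : Prop :=
  ~ {subset x <= y} /\ ~ {subset y <= x}.

(** Choose sets greedily, each of least size among those that contain no set chosen
before. The chosen sets are pairwise incomparable, so at most m of them can be
chosen, and then every set contains a chosen one: their heads hit everything. *)
Lemma small_hitting_set (F : set (seq nat)) m :
  (forall x, F x -> uniq x) -> (forall x, F x -> x != [::]) ->
  ~ clique incomparable m.+1 F ->
  exists M : seq nat, [/\ (size M <= m)%N, forall p, p \in M -> exists2 x, F x & p \in x &
    forall x, F x -> exists2 p, p \in M & p \in x].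
Proof.
move=> Fu F0 Fc.
pose dom k (c : nat -> seq nat) (x : seq nat) := exists2 i, (i < k)%N & {subset c i <= x}.
have greedy k : (exists c, [/\ forall i, (i < k)%N -> F (c i),
      forall i j, (i < j)%N -> (j < k)%N -> incomparable (c i) (c j) &
      forall x, F x -> ~ dom k c x -> forall i, (i < k)%N -> (size (c i) <= size x)%N])
  \/ (exists k' c, [/\ (k' < k)%N, forall i, (i < k')%N -> F (c i) &
      forall x, F x -> dom k' c x]).
  elim: k => [|k [[c [cF ci cs]]|]]; first by left; exists (fun=> [::]).
    have [all|] := pselect (forall x, F x -> dom k c x).
      by right; exists k, c.
    move=> /existsNP[x0 /not_implyP[Fx0 nd0]]; left.
    have ex : exists s, `[< exists x, [/\ F x, ~ dom k c x & size x = s] >].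
      by exists (size x0); apply/asboolP; exists x0.
    case: (ex_minnP ex) => s /asboolP[x [Fx ndx sx]] smin.
    exists (fun i => if (i < k)%N then c i else x); split.
    - by move=> i _; case: ltnP => // ik; exact: cF.
    - move=> i j ij; rewrite ltnS => jk.
      have ik : (i < k)%N := leq_trans ij jk.
      rewrite ik; case: (ltnP j k) => jk'; first exact: ci.
      split=> [h|h]; first by apply: ndx; exists i.
      case: (ndx); exists i => // y yc.
      by have [_ ->] := uniq_min_size (Fu _ Fx) h (cs x Fx ndx i ik).
    - move=> z Fz ndz i; rewrite ltnS => ik.
      have ndz' : ~ dom k c z.
        move=> [i' i'k h]; apply: ndz; exists i'; first by rewrite ltnS ltnW.
        by rewrite i'k.
      case: (ltnP i k) => ik'; first exact: cs.
      by rewrite sx; apply: smin; apply/asboolP; exists z.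
  by move=> [k' [c [k'k cF cd]]]; right; exists k', c; split=> //; rewrite ltnS ltnW.
have [[c [cF ci _]]|[k [c [km cF cd]]]] := greedy m.+1.
  by case: Fc; exists c.
exists [seq head 0%N (c i) | i <- iota 0 k]; split.
- by rewrite size_map size_iota -ltnS.
- move=> p /mapP[i]; rewrite mem_iota => /= /cF Fi ->; exists (c i) => //.
  by move: (F0 _ Fi); case: (c i) => //= a l _; exact: mem_head.
move=> x /cd[i ik h]; exists (head 0%N (c i)).
  by apply/mapP; exists i; rewrite ?mem_iota.
by apply: h; move: (F0 _ (cF i ik)); case: (c i) => //= a l _; exact: mem_head.
Qed.

(** Cut nat into finite blocks so long that every T w meets almost all of them, and
label w by the trace of T w on the blocks. Along a tower the traces of two
members are eventually comparable, so [clique_free] and [small_hitting_set] give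
n points in each block that are enough to hit all traces of uncountably many
members, hence almost all traces of each member. Take such hitting sets M i of
the least possible size r. If T w omitted a point of M i for infinitely many i,
the remaining points of these M i would be smaller hitting sets. So every T w
contains almost all M i, and any point of M i will do. *)
Lemma tower_pseudo_intersection (T : W -> set nat) :
  (forall w m, exists2 i, (m <= i)%N & T w i) ->
  (forall v w, v < w -> for_large (fun i => T w i -> T v i)) ->
  exists b : nat -> nat, (forall i, (i <= b i)%N) /\
    forall w, for_large (fun i => T w (b i)).
Proof.
move=> Tinf Tch.
have [_ nW _] := W1.
have /choice[nx nxP] : forall p : W * nat, exists i, (p.2 <= i)%N /\ T p.1 i.
  by move=> [w m]; have [i] := Tinf w m; exists i.
have [h hP] := dominate_small (fun w m => nx (w, m)) (small_W W1).
(* h bounds the next element of each T w from almost every starting point, so the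
   interval from a i to a i.+1 meets T w for almost all i. *)
pose a := fix a i := if i is j.+1 then (maxn (a j) (h (a j))).+1 else 0%N.
have aS i : (a i < a i.+1)%N by rewrite /= ltnS leq_maxl.
have ai i : (i <= a i)%N by elim: i => // i ih; exact: leq_ltn_trans ih (aS i).
pose lab i w := [seq m <- iota (a i) (a i.+1 - a i) | `[< T w m >]].
have labE i w m : (m \in lab i w) = [&& (a i <= m)%N, (m < a i.+1)%N & `[< T w m >]].
  rewrite mem_filter mem_iota subnKC; last exact: ltnW.
  by rewrite andbC andbA.
have [|||Y [_ nY cY]] := clique_free n_gt0 KH (lab := lab)
    (r := fun i u v => incomparable (lab i u) (lab i v)) nW.
- by move=> i u u' v v' -> ->.
- by move=> i v [h1 _]; apply: h1.
- have ev u v : u < v -> for_large (fun i => {subset lab i v <= lab i u}).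
    move=> /Tch[k kP]; exists k => i ki m; rewrite !labE => /and3P[am -> /asboolP Tm].
    rewrite am /=; apply/asboolP; apply: kP => //; exact: leq_trans (leq_trans ki (ai i)) am.
  move=> u v _ _; case: (ltgtP u v) => [/ev|/ev|->].
  + by apply: for_large_sub => i hi [_].
  + by apply: for_large_sub => i hi [].
  + by exists 0%N => i _ [h1 _]; apply: h1.
have /choice[M0 M0P] : forall i, exists M : seq nat, [/\ (size M <= n)%N,
    forall p, p \in M -> (i <= p)%N &
    forall w, Y w -> lab i w != [::] -> exists2 p, p \in M & p \in lab i w].
  move=> i; pose F := [set x | exists2 w, Y w & x = lab i w /\ x != [::]].
  have [|||M [sM MF hM]] := @small_hitting_set F n.
  - by move=> x [w _ [-> _]]; rewrite filter_uniq // iota_uniq.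
  - by move=> x [w _ []].
  - move=> [c [cF ci]]; apply: (cY i).
    have /choice[d dP] : forall j, exists w, (j < n.+1)%N -> Y w /\ c j = lab i w.
      move=> j; have [jn|_] := ltnP j n.+1; last by have [w _] := omega1_inhabited W1; exists w.
      by have [w Yw [e _]] := cF j jn; exists w.
    exists d; split=> [j /dP[]//|j j' jj' j'n].
    have [_ <-] := dP j (ltn_trans jj' j'n); have [_ <-] := dP j' j'n; exact: ci.
  exists M; split=> // [p /MF[_ [w _ [-> _]]]|w Yw w0].
    by rewrite labE => /andP[ap _]; exact: leq_trans ap.
  by apply: hM; exists w.
pose hit r := `[< exists M : nat -> seq nat, [/\ forall i, (size (M i) <= r)%N,
    forall i p, p \in M i -> (i <= p)%N &
    forall w, for_large (fun i => exists2 p, p \in M i & T w p)] >].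
have exhit : exists r, hit r.
  exists n; apply/asboolP; exists M0; split=> [i|i|w]; try by case: (M0P i).
  have [y Yy wy] := uncountable_unbounded W1 nY w.
  have [k kP] := for_largeI (Tch _ _ wy) (hP y).
  exists k => i ki.
  have ne : lab i y != [::].
    have [_ hh] := kP (a i) (leq_trans ki (ai i)); have [le Ty] := nxP (y, a i).
    have : nx (y, a i) \in lab i y.
      rewrite labE le /= ltnS leq_max hh orbT /=; exact/asboolP.
    by case: (lab i y).
  have [_ _ /(_ y Yy ne)[p pM]] := M0P i.
  rewrite labE => /and3P[ap _ /asboolP Tp]; exists p => //.
  have [le _] := kP p (leq_trans (leq_trans ki (ai i)) ap); exact: le.
case: (ex_minnP exhit) => r /asboolP[M [Mr Mi Mh]] rmin.
have Mall w : for_large (fun i => forall p, p \in M i -> T w p).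
  apply: contrapT => nl.
  have /choice[phi phiP] : forall k, exists i, (k <= i)%N /\ ~ (forall p, p \in M i -> T w p).
    move=> k; apply: contrapT => hk; apply: nl; exists k => i ki.
    by apply: contrapT => hi; apply: hk; exists i.
  (* phi enumerates indices where T w omits a point; hit r.-1 will be witnessed
     by the traces of T w on the sets M (phi k). *)
  suff : hit r.-1.
    have r0 : (0 < r)%N.
      rewrite lt0n; apply/eqP => r0; have [_] := phiP 0%N; apply => p.
      by have := Mr (phi 0%N); rewrite r0 leqn0 size_eq0 => /eqP ->.
    by move=> /rmin; rewrite -ltnS prednK // ltnn.
  apply/asboolP; exists (fun k => [seq p <- M (phi k) | `[< T w p >]]); split.
  - move=> k; have [_ /existsNP[p /not_implyP[pM nTp]]] := phiP k.
    have : (size [seq p <- M (phi k) | `[< T w p >]] < r)%N.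
      apply: leq_trans (Mr (phi k)); rewrite size_filter -(count_predC (fun p => `[< T w p >])).
      rewrite -addn1 leq_add2l -has_count; apply/hasP; exists p => //=.
      by apply/asboolPn.
    by case: (r) => // r' ; rewrite ltnS.
  - move=> k p; rewrite mem_filter => /andP[_ /Mi]; apply: leq_trans.
    by have [] := phiP k.
  (* A later member of the tower is almost contained in both T v and T w, so a
     point of M (phi k) that it hits also counts for T v. *)
  move=> v; pose u := Order.max v w.
  have ev x : x <= u -> for_large (fun i => T u i -> T x i).
    by rewrite le_eqVlt => /orP[/eqP->|/Tch//]; exists 0%N.
  have vu : v <= u by rewrite le_max lexx.
  have wu : w <= u by rewrite le_max lexx orbT.
  have [k kP] := for_largeI (Mh u) (for_largeI (ev v vu) (ev w wu)).
  exists k => i ki; have [kphi _] := phiP i.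
  have ki' := leq_trans ki kphi.
  have [[p pM Tp] _] := kP _ ki'.
  have [_ [Tv Tw]] := kP p (leq_trans ki' (Mi _ _ pM)).
  by exists p; [rewrite mem_filter pM andbT; apply/asboolP; exact: Tw|exact: Tv].
have [w0 _] := omega1_inhabited W1.
exists (fun i => head i (M i)); split=> [i|w].
  by case: (M i) (Mi i) => //= p l; apply; rewrite mem_head.
have [k kP] := for_largeI (Mall w) (Mh w0).
exists k => i /kP[h1 [p pM _]]; apply: h1.
by case: (M i) pM => //= q l _; rewrite mem_head.
Qed.

(** It is enough to find a tower T such that T w is almost contained in the A j of
rank at most w, and to keep T w positive: infinite on every finite intersection
of sets A j. At stage w, list as e the countably many sets in which T w has to
be almost contained. Every finite intersection of A's meets the first k of them
in arbitrarily large points; a function F that dominates the search for such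
points for all finite intersections, given by [dominate_small], defines T w as
the set of i that lie, for some k, between k and F k and in the first k+1 sets. *)
Lemma pseudo_intersection (J : eqType) (A : J -> set nat) : small W J ->
  (forall (s : seq J) m, exists2 i, (m <= i)%N & forall j, j \in s -> A j i) ->
  exists b : nat -> nat, (forall i, (i <= b i)%N) /\
    forall j, for_large (fun i => A j (b i)).
Proof.
move=> sJ Acent; have [rk rkP] := sJ.
pose Phi (w : W) (g : W -> set nat) (t : set nat) :=
  [/\ forall v, v < w -> for_large (fun i => t i -> g v i),
      forall j, rk j <= w -> for_large (fun i => t i -> A j i) &
      forall (s : seq J) m, exists2 i, (m <= i)%N & t i /\ forall j, j \in s -> A j i].
have [|||T TP] := @wf_choice _ _ W1 _ Phi; last 1 first.
- have [||b [bi bT]] := @tower_pseudo_intersection T.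
  + by move=> w m; have [_ _ /(_ [::] m)[i mi [Ti _]]] := TP w; exists i.
  + by move=> v w vw; have [/(_ v vw)] := TP w.
  exists b; split=> // j; have [_ /(_ j (lexx _)) [k kP] _] := TP (rk j).
  have [l lP] := bT (rk j); exists (maxn k l) => i; rewrite geq_max => /andP[ki li].
  by apply: kP (lP i li); exact: leq_trans ki (bi i).
- by move=> w g g' t gg' [h1 h2 h3]; split=> // v vw; rewrite -gg' //; exact: h1.
- move=> w g ih.
  pose C : set (set nat) := (((g @` [set v | v < w]) `|` (A @` [set j | rk j <= w])) `|` [set setT])%classic.
  have cC : countable C.
    apply: countable_setU; last exact: countable1.
    apply: countable_setU; first apply: sub_countable (card_image_le _ _) _.
      by have [_ _] := W1; apply.
    exact: sub_countable (card_image_le _ _) (rkP w).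
  have [e [eC Ce]] := countable_enum cC (or_intror erefl : C setT).
  (* Finitely many of the sets e l almost include the trace of one earlier member
     of the tower, or of the whole of nat, on one finite intersection. *)
  have base k : exists (B : set nat) (S : seq J),
      (B = setT \/ exists2 v, v < w & B = g v) /\
      for_large (fun i => B i -> (forall j, j \in S -> A j i) ->
        forall l, (l < k)%N -> e l i).
    elim: k => [|k [B [S [Bw [k0 kP]]]]].
      by exists setT, [::]; split; [left|exists 0%N].
    have ext (B' : set nat) (S' : seq J) : (B' = setT \/ exists2 v, v < w & B' = g v) ->
        for_large (fun i => B' i -> B i) -> {subset S <= S'} ->
        for_large (fun i => B' i -> (forall j, j \in S' -> A j i) -> e k i) ->
        exists (B : set nat) (S : seq J),
        (B = setT \/ exists2 v, v < w & B = g v) /\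
        for_large (fun i => B i -> (forall j, j \in S -> A j i) ->
          forall l, (l < k.+1)%N -> e l i).
      move=> B'w [k1 k1P] SS' [k2 k2P]; exists B', S'; split=> //.
      exists (maxn k0 (maxn k1 k2)) => i; rewrite !geq_max => /and3P[i0 i1 i2] B'i S'i l.
      rewrite ltnS leq_eqVlt => /predU1P[->|lk]; first exact: k2P.
      by apply: kP => //; [exact: k1P|move=> j /SS'; exact: S'i].
    have refl B' : for_large (fun i => B' i -> B' i :> Prop) by exists 0%N.
    have [[[v vw ev]|[j jw ej]]|et] := eC k.
    + have gg v1 v2 : v1 <= v2 -> v2 < w -> for_large (fun i => g v2 i -> g v1 i).
        rewrite le_eqVlt => /orP[/eqP->|lt] v2w; first exact: refl.
        by have [/(_ v1 lt)] := ih v2 v2w.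
      case: Bw => [BT|[v' v'w Bv']].
        apply: (ext (g v) S) => //; first by right; exists v.
          by rewrite BT; exists 0%N.
        by rewrite -ev; exists 0%N.
      pose u := Order.max v v'.
      have uw : u < w by rewrite gt_max vw.
      apply: (ext (g u) S) => //; first by right; exists u.
        by rewrite Bv'; apply: gg uw; rewrite le_max lexx orbT.
      have [|k1 k1P] := gg v u _ uw; first by rewrite le_max lexx.
      by rewrite -ev; exists k1 => i i1 + _; exact: k1P.
    + apply: (ext B (j :: S)) => //; first by move=> x; rewrite inE orbC => ->.
      by rewrite -ej; exists 0%N => i _ _; apply; exact: mem_head.
    + by apply: (ext B S) => //; exists 0%N => i _ _ _; rewrite et.
  have pos k (s : seq J) m : exists i, [/\ (m <= i)%N, forall l, (l < k)%N -> e l i &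
      forall j, j \in s -> A j i].
    have [B [S [Bw [k0 kP]]]] := base k.
    have [i mi [Bi Ai]] : exists2 i, (maxn m k0 <= i)%N &
        B i /\ forall j, j \in S ++ s -> A j i.
      case: Bw => [->|[v vw ->]].
        by have [i mi Ai] := Acent (S ++ s) (maxn m k0); exists i.
      by have [_ _] := ih v vw; apply.
    move: mi; rewrite geq_max => /andP[mi ki]; exists i; split=> //.
      by apply: kP => // j jS; apply: Ai; rewrite mem_cat jS.
    by move=> j js; apply: Ai; rewrite mem_cat js orbT.
  have /choice[f fP] : forall p : seq J * nat, exists i, [/\ (p.2 <= i)%N,
      forall l, (l < p.2.+1)%N -> e l i & forall j, j \in p.1 -> A j i].
    by move=> [s m]; exact: pos.
  have [F FP] := dominate_small (fun s m => f (s, m)) (small_seq W1 sJ).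
  pose t i := exists k, [/\ (k <= i)%N, (i <= F k)%N & forall l, (l < k.+1)%N -> e l i].
  have te l : for_large (fun i => t i -> e l i).
    exists (\max_(k < l) F k).+1%N => i li [k [ki iF ek]]; apply: ek; rewrite ltnS.
    rewrite leqNgt; apply/negP => kl.
    have := @leq_bigmax _ (fun k : 'I_l => F k) (Ordinal kl).
    by move=> /(leq_trans iF)/(leq_trans li); rewrite ltnn.
  exists t; split.
  + by move=> v vw; have [|l <-] := Ce (g v) => //; left; left; exists v.
  + by move=> j jw; have [|l <-] := Ce (A j) => //; left; right; exists j.
  + move=> s m; have [k kP] := FP s; have [h1 h2 h3] := fP (s, maxn m k).
    exists (f (s, maxn m k)); first by apply: leq_trans h1; exact: leq_maxl.
    split=> //; exists (maxn m k); split=> //; exact/kP/leq_maxr.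
- exact: (inhabits setT).
Qed.
End Towers.

(** * Generic families for sigma-centered preorders *)

Section CenteredGeneric.
Context (n : nat) (n_gt0 : (0 < n)%N).
Context (KH : forall (d : Order.disp_t) (P : porderType d),
  sigma_linked n P -> property_K n.+1 P).
Context (dW : Order.disp_t) (W : orderType dW) (W1 : is_omega1 W).

Lemma injective_large (h : nat -> nat) : injective h ->
  forall x, for_large (fun k => x <= h k)%N.
Proof.
move=> hi; elim=> [|x [k0 k0P]]; first by exists 0%N.
have [[k1 k1x]|nx] := pselect (exists k, h k = x); last first.
  exists k0 => k /k0P; rewrite leq_eqVlt => /orP[/eqP e|//].
  by case: nx; exists k.
exists (maxn k0 k1.+1) => k; rewrite geq_max => /andP[/k0P + k1k].
rewrite leq_eqVlt => /orP[/eqP e|//].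
by move: k1k; rewrite (hi k k1) ?ltnn // k1x.
Qed.

(** Every class is coded by infinitely many numbers, so that the sets of codes of
the possible moves in [centered_generic] are infinite. *)
Lemma logn_large a m : exists2 i, (m <= i)%N & logn 2 i = a.
Proof.
exists (2 ^ a * m.*2.+1)%N.
  apply: (@leq_trans m.*2.+1); first by rewrite -addnn -addSn leq_addl.
  by rewrite leq_pmull // expn_gt0.
rewrite lognM ?expn_gt0 // pfactorK // logn_coprime ?addn0 //.
by rewrite coprime2n /= odd_double.
Qed.

(** Bell's argument. A state assigns to each j a condition, all conditions in a
state being of the same class, so that finitely many have a lower bound. A move
of j is an extension that meets D j. The sets of classes available to the moves
of j form a centered family, because a common lower bound of finitely many
conditions can be extended into all the corresponding dense sets. Along a
pseudo-intersection b, the i-th new state moves to the class coded by b i all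
those j that have a move to it; each j moves for almost all i. Iterating gives a
tree of states, and a branch that grows fast enough, by [dominate_small], makes
every j move at almost all nodes of the branch. *)
Lemma centered_generic (T : Type) (R : T -> T -> Prop) (kap : T -> nat)
    (J : eqType) (D : J -> set T) :
  (forall t, R t t) -> (forall x y z, R x y -> R y z -> R x z) ->
  (forall (f : nat -> T) m c, (forall i, (i < m)%N -> kap (f i) = c) ->
     exists t, forall i, (i < m)%N -> R t (f i)) ->
  small W J ->
  (forall j t t', D j t -> R t' t -> D j t') ->
  (forall j t, exists2 t', D j t' & R t' t) ->
  T -> exists g : J -> T, (forall j, D j (g j)) /\
    forall s : seq J, exists t, forall j, j \in s -> R t (g j).
Proof.
move=> Rr Rt cent sJ Dopen Ddense p0.
pose coh (p : J -> T) := exists c, forall j, kap (p j) = c.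
have cohlb p (s : seq J) : coh p -> exists t, forall j, j \in s -> R t (p j).
  move=> [c pc]; case: s => [|j0 s]; first by exists p0.
  have [|t tP] := cent (fun i => p (nth j0 (j0 :: s) i)) (size (j0 :: s)) c.
    by move=> i _.
  by exists t => j js; rewrite -(nth_index j0 js); apply: tP; rewrite index_mem.
have extend (s : seq J) t : exists2 t', R t' t & forall j, j \in s -> D j t'.
  elim: s => [|j s [t1 t1t t1D]]; first by exists t.
  have [t2 t2D t21] := Ddense j t1; exists t2; first exact: Rt t21 t1t.
  by move=> k; rewrite inE => /predU1P[->//|/t1D/Dopen]; exact.
have /choice[NX NXP] : forall p, exists q : nat -> J -> T, coh p ->
    (forall i, coh (q i)) /\
    (forall j, for_large (fun i => R (q i j) (p j) /\ D j (q i j))).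
  move=> p; have [cp|] := pselect (coh p); last by exists (fun _ => p).
  pose mv j m := exists q, [/\ R q (p j), D j q & kap q = logn 2 m].
  have [|b [_ bP]] := pseudo_intersection n_gt0 KH W1 (A := mv) sJ.
    move=> s m; have [t tP] := cohlb p s cp; have [t' t't t'D] := extend s t.
    have [i mi ia] := logn_large (kap t') m; exists i => // j js.
    exists t'; split=> //; [exact: Rt t't (tP j js)|exact: t'D].
  have /choice[q qP] : forall i, exists q : J -> T, coh q /\
      forall j, mv j (b i) -> R (q j) (p j) /\ D j (q j).
    move=> i; have [[d dc]|nd] := pselect (exists d, kap d = logn 2 (b i)); last first.
      exists (fun=> p0); split; first by exists (kap p0).
      by move=> j [q [_ _ qc]]; case: nd; exists q.
    have /choice[q qP] : forall j, exists q, kap q = logn 2 (b i) /\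
        (mv j (b i) -> R q (p j) /\ D j q).
      by move=> j; have [[q [? ? ?]]|nm] := pselect (mv j (b i)); [exists q|exists d].
    by exists q; split=> [|j]; [exists (logn 2 (b i)) => j|]; case: (qP j).
  exists q => _; split=> [i|j]; first by case: (qP i).
  have [k kP] := bP j; exists k => i /kP; have [_] := qP i; exact.
(* Nodes are lists of choices, the last choice at the head. *)
pose st := fix st (s : seq nat) : J -> T := if s is i :: s' then NX (st s') i else fun=> p0.
have stc s : coh (st s).
  by elim: s => [|i s /NXP[h _]] /=; [exists (kap p0)|exact: h].
have /choice[thr thrP] : forall p : J * seq nat, exists k, forall i, (k <= i)%N ->
    R (st (i :: p.2) p.1) (st p.2 p.1) /\ D p.1 (st (i :: p.2) p.1).
  by move=> [j s]; have [_ /(_ j)[k kP]] := NXP _ (stc s); exists k.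
have [G GP] := dominate_small n_gt0 KH W1
  (fun j x => if choice.unpickle x is Some s then thr (j, s) else 0%N) sJ.
pose br := fix br k : seq nat := if k is k'.+1 then G (choice.pickle (br k')) :: br k' else [::].
have br_size k : size (br k) = k by elim: k => //= k ->.
have br_inj : injective (fun k => choice.pickle (br k)).
  by move=> k l /(pcan_inj choice.pickleK)/(congr1 size); rewrite !br_size.
have /choice[kj kjP] : forall j, exists k0, forall k, (k0 <= k)%N ->
    R (st (br k.+1) j) (st (br k) j) /\ D j (st (br k.+1) j).
  move=> j; have [x xP] := GP j; have [k0 k0P] := injective_large br_inj x.
  by exists k0 => k /k0P/xP; rewrite choice.pickleK => /(thrP (j, br k)).
(* After kj j, the conditions of j decrease along the branch; so the state at a
   late node is below the finitely many values of g in question. *)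
exists (fun j => st (br (kj j).+1) j); split=> [j|s].
  by have [] := kjP j (kj j) (leqnn _).
have [t tP] := cohlb _ s (stc (br (\max_(j <- s) (kj j).+1)%N)).
exists t => j js; apply: (Rt _ _ _ (tP j js)).
have := @leq_bigmax_seq _ _ xpredT (fun j => (kj j).+1) _ js isT.
elim: (\max_(j <- s) (kj j).+1)%N => // k ih; rewrite leq_eqVlt => /predU1P[<-|] //.
rewrite ltnS => jk; apply: (Rt _ _ _ _ (ih jk)); have [|//] := kjP j k; exact: ltnW.
Qed.
End CenteredGeneric.

(** * Uncountable centered families *)

Fixpoint words (X : Type) (A : seq X) r : seq (seq X) :=
  if r is r'.+1 then [seq a :: l | a <- A, l <- words A r'] else [:: [::]].

Lemma mem_words (X : eqType) (A : seq X) (l : seq X) :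
  {subset l <= A} -> l \in words A (size l).
Proof.
elim: l => //= a l ih lA; apply/allpairsP; exists (a, l); split=> //=.
  by apply: lA; rewrite mem_head.
by apply: ih => x xl; apply: lA; rewrite inE xl orbT.
Qed.

Section CenteredFamily.
Context (n : nat) (n_gt0 : (0 < n)%N).
Context (dW : Order.disp_t) (W : orderType dW) (W1 : is_omega1 W).
Local Open Scope order_scope.

Lemma distinct_reals : exists x : W -> nat -> nat, injective x.
Proof.
have [|||x xP] := @wf_choice _ _ W1 (nat -> nat) (fun w g t => forall v, v < w -> g v <> t).
- by move=> w g g' t gg' h v vw; rewrite -gg' //; exact: h.
- move=> w g _; have [e eP] : exists e : nat -> nat -> nat, forall v, v < w -> exists i, e i = g v.
    have [[v0 v0w]|h] := pselect (exists v, v < w); last first.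
      by exists (fun=> id) => v vw; case: h; exists v.
    have [|//|e [_ eP]] := @countable_enum _ (g @` [set v | v < w]) (g v0).
      by have [_ _ cw] := W1; exact: sub_countable (card_image_le _ _) (cw w).
    by exists e => v vw; apply: eP; exists v.
  exists (fun i => (e i i).+1) => v /eP[i <-] /(congr1 (fun f => f i)) /eqP.
  by rewrite ltn_eqF.
- exact: (inhabits id).
exists x => u v e; case: (ltgtP u v) => // [uv|vu]; first by case: (xP v u uv).
by case: (xP u v vu).
Qed.

Lemma countable_bounded (A : set W) : countable A -> exists w, forall a, A a -> a <= w.
Proof.
move=> cA; apply: contrapT => h; apply: (unbounded_uncountable W1) cA => w.
apply: contrapT => hw; apply: h; exists w => a Aa.
by rewrite leNgt; apply/negP => wa; apply: hw; exists a.
Qed.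

Context (K : seq W -> Prop).
Context (Kher : forall s t : seq W, {subset t <= s} -> K s -> K t).
Context (K1 : forall a, K [:: a]).
Context (col : seq W -> nat).
Context (Kmerge : forall (f : nat -> seq W) c,
  (forall i, (i < n)%N -> K (f i) /\ col (f i) = c) ->
  K (flatten [seq f i | i <- iota 0 n])).

(** A point may carry no label at a coordinate: in an amalgam this happens to points
shared by conditions to which the coordinate gives different labels. *)
Definition conflict (z : W -> nat -> option nat) j (u v : W) :=
  exists a b, [/\ z u j = Some a, z v j = Some b & a <> b].

(** The promise made by a condition: cliques of distinct labels are the only
obstruction to K. *)
Definition labelled_ok (s : seq W) k z := sorted <%O s /\
  forall X : seq W, {subset X <= s} ->
    (forall j, (j < k)%N -> ~ clique (conflict z j) n.+1 [set` X]) -> K X.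

Record labelled := Labelled {
  supp : seq W; len : nat; lbl : W -> nat -> option nat;
  lblP : labelled_ok supp len lbl }.

(** New coordinates create no conflicts between old points. Hence in a generic
family any two points are in conflict at finitely many coordinates only, as
[clique_free] requires. *)
Definition refines (q' q : labelled) :=
  [/\ {subset supp q <= supp q'}, (len q <= len q')%N,
      forall u j, u \in supp q -> (j < len q)%N -> lbl q' u j = lbl q u j &
      forall j u v, (len q <= j)%N -> (j < len q')%N -> u \in supp q -> v \in supp q ->
        ~ conflict (lbl q') j u v].

Lemma refines_refl q : refines q q.
Proof. by split=> // j u v qj jq; move: (leq_ltn_trans qj jq); rewrite ltnn. Qed.

Lemma refines_trans q1 q2 q3 : refines q1 q2 -> refines q2 q3 -> refines q1 q3.
Proof.
move=> [s12 k12 z12 c12] [s23 k23 z23 c23]; split.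
- by move=> u /s23/s12.
- exact: leq_trans k12.
- move=> u j us jk; rewrite z12 ?z23 //; [exact: s23|exact: leq_trans k23].
- move=> j u v kj jk us vs; have [j2|j2] := ltnP j (len q2); last first.
    by apply: c12 => //; exact: s23.
  move=> [a [b]]; rewrite !z12 //; [|exact: s23|exact: s23] => h.
  by apply: (c23 j u v kj j2 us vs); exists a, b.
Qed.

(**
The class of a condition describes it up to isomorphism, together with the
colours of all lists of its points; the remaining data ensure that conditions of
the same class fit together. Prefixes of distinct reals attached to the points
of W make a common point of two supports occupy the same position in both.
Injections [e g] from the predecessors of g to nat make the two supports agree
below such a point.

In the amalgam of m conditions, there is a new coordinate for each function l
from m to m; the point u gets the label l i there if l takes the value l i at
all conditions whose supports contain u, and no label if l is not constant
there. This does not create conflicts inside one support. Conversely, the sets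
of conditions containing u form a laminar family as u varies, because supports
agree below common points. So a set X without cliques is covered by the traces
of the conditions that contain the maximal points of X, and there are at most n
of these, for otherwise a function l that separates the disjoint sets of
conditions attached to n+1 maximal points would give a clique. These traces,
moved to the same positions, have the same colour, and so the union is in K.
*)
Lemma labelled_sigma_centered : exists kap : labelled -> nat,
  forall (f : nat -> labelled) m c, (forall i, (i < m)%N -> kap (f i) = c) ->
  exists t, forall i, (i < m)%N -> refines t (f i).
Proof.
have [x xinj] := distinct_reals.
have [w0 _] := omega1_inhabited W1.
have /choice[e eP] : forall g : W, exists e : W -> nat,
    forall u v, u < g -> v < g -> e u = e v -> u = v.
  by move=> g; have [_ _ /(_ g)/countable_code] := W1.
have /choice[lx lxP] : forall q, exists l, forall u v,
    u \in supp q -> v \in supp q -> mkseq (x u) l = mkseq (x v) l -> u = v.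
  move=> q.
  have [|l lP] := @for_large_seq _ (supp q)
      (fun u l => forall v, v \in supp q -> mkseq (x u) l = mkseq (x v) l -> u = v).
    move=> u us; apply: for_large_seq => v vs.
    have [->|ne] := pselect (u = v); first by exists 0%N.
    have /existsNP[i xi] : ~ forall i, x u i = x v i.
      by move=> h; apply: ne; apply: xinj; apply: functional_extensionality_dep.
    by exists i.+1 => l il /mkseq_eq h; case: xi; exact: h.
  by exists l => u v us vs; exact: lP.
pose el q p := nth w0 (supp q) p.
pose kap q := choice.pickle (size (supp q), len q,
  [seq mkseq (lbl q u) (len q) | u <- supp q],
  [seq [seq e v u | u <- supp q] | v <- supp q],
  [seq col [seq el q p | p <- l] | l <- words (iota 0 (size (supp q))) (size (supp q))],
  (lx q, [seq mkseq (x u) (lx q) | u <- supp q])).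
exists kap => f m c fc.
have [->|m0] := posnP m.
  suff h : labelled_ok [::] 0 (fun _ _ => None) by exists (Labelled h).
  by split=> // X X0 _; apply: Kher (K1 w0) => u /X0.
have kapE i : (i < m)%N -> kap (f i) = kap (f 0%N) by move=> im; rewrite !fc.
pose r := size (supp (f 0%N)); pose k := len (f 0%N); pose E i p := el (f i) p.
have szE i : (i < m)%N -> size (supp (f i)) = r.
  by move=> /kapE/(pcan_inj choice.pickleK)[].
have lenE i : (i < m)%N -> len (f i) = k.
  by move=> /kapE/(pcan_inj choice.pickleK)[].
have lxE i : (i < m)%N -> lx (f i) = lx (f 0%N).
  by move=> /kapE/(pcan_inj choice.pickleK)[].
have Emem i p : (i < m)%N -> (p < r)%N -> E i p \in supp (f i).
  by move=> im pr; apply: mem_nth; rewrite szE.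
have memE i u : (i < m)%N -> u \in supp (f i) -> exists2 p, (p < r)%N & E i p = u.
  move=> im us; exists (index u (supp (f i))); first by rewrite -(szE i im) index_mem.
  exact: nth_index.
have nthmap (Y : Type) (y0 : Y) (g : W -> Y) i p : (i < m)%N -> (p < r)%N ->
    nth y0 [seq g u | u <- supp (f i)] p = g (E i p).
  by move=> im pr; rewrite (nth_map w0) // szE.
have lblE i i' p j : (i < m)%N -> (i' < m)%N -> (p < r)%N -> (j < k)%N ->
    lbl (f i) (E i p) j = lbl (f i') (E i' p) j.
  move=> + + pr jk.
  suff h a : (a < m)%N -> lbl (f a) (E a p) j = lbl (f 0%N) (E 0%N p) j.
    by move=> im im'; rewrite h // h.
  move=> am; have /(pcan_inj choice.pickleK)[_ _ + _ _ _ _] := kapE a am.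
  move=> /(congr1 (fun l => nth [::] l p)); rewrite !nthmap // (lenE a am) => /(congr1 (fun l => nth None l j)).
  by rewrite !nth_mkseq.
have eE i i' p p' : (i < m)%N -> (i' < m)%N -> (p < r)%N -> (p' < r)%N ->
    e (E i p) (E i p') = e (E i' p) (E i' p').
  move=> + + pr p'r.
  suff h a : (a < m)%N -> e (E a p) (E a p') = e (E 0%N p) (E 0%N p').
    by move=> im im'; rewrite h // h.
  move=> am; have /(pcan_inj choice.pickleK)[_ _ _ + _ _ _] := kapE a am.
  by move=> /(congr1 (fun l => nth 0%N (nth [::] l p) p')); rewrite !nthmap.
have colE i i' l : (i < m)%N -> (i' < m)%N -> size l = r -> {subset l <= iota 0 r} ->
    col [seq E i p | p <- l] = col [seq E i' p | p <- l].
  move=> + + sl lr.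
  suff h a : (a < m)%N -> col [seq E a p | p <- l] = col [seq E 0%N p | p <- l].
    by move=> im im'; rewrite h // h.
  move=> am; have /(pcan_inj choice.pickleK)[_ _ _ _ + _ _] := kapE a am.
  rewrite (szE a am) -/r => /eq_in_map; apply.
  by rewrite -sl; apply: mem_words; rewrite sl.
have xE i i' p : (i < m)%N -> (i' < m)%N -> (p < r)%N ->
    mkseq (x (E i p)) (lx (f 0%N)) = mkseq (x (E i' p)) (lx (f 0%N)).
  move=> + + pr.
  suff h a : (a < m)%N -> mkseq (x (E a p)) (lx (f 0%N)) = mkseq (x (E 0%N p)) (lx (f 0%N)).
    by move=> im im'; rewrite h // h.
  move=> am; have /(pcan_inj choice.pickleK)[_ _ _ _ _ _ +] := kapE a am.
  by move=> /(congr1 (fun l => nth [::] l p)); rewrite !nthmap // (lxE a am).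
have srt i : sorted <%O (supp (f i)) by have [] := lblP (f i).
have Einj i p p' : (i < m)%N -> (p < r)%N -> (p' < r)%N -> E i p = E i p' -> p = p'.
  move=> im pr p'r /eqP; rewrite /E /el nth_uniq ?szE // => [/eqP//|].
  exact: lt_sorted_uniq.
have Epos i i' p p' : (i < m)%N -> (i' < m)%N -> (p < r)%N -> (p' < r)%N ->
    E i p = E i' p' -> p = p'.
  move=> im im' pr p'r h; apply: (Einj i) => //.
  by apply: (lxP (f i)); rewrite ?Emem // lxE // h; exact: xE.
have Elow i i' p p' : (i < m)%N -> (i' < m)%N -> (p < r)%N -> (p' <= p)%N ->
    E i p = E i' p -> E i p' = E i' p'.
  move=> im im' pr; rewrite leq_eqVlt => /predU1P[->//|p'p] h.
  have lt a : (a < m)%N -> E a p' < E a p.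
    by move=> am; apply: (sorted_ltn_nth lt_trans) => //; rewrite inE szE // (ltn_trans p'p).
  apply: (eP (E i p)); [exact: lt|by rewrite h; exact: lt|].
  by rewrite {2}h; apply: eE => //; exact: ltn_trans pr.
have /choice[pos posP] : forall u, exists p, forall i, (i < m)%N -> u \in supp (f i) ->
    (p < r)%N /\ E i p = u.
  move=> u; have [[i [im us]]|h] := pselect (exists i, (i < m)%N /\ u \in supp (f i)); last first.
    by exists 0%N => i im us; case: h; exists i.
  have [p pr pu] := memE i u im us; exists p => i' im' us'.
  have [p' p'r p'u] := memE i' u im' us'.
  by rewrite (Epos i i' p p') // pu p'u.
(* [L h] is the h-th function from m to m, and gives the coordinate k + h. *)
pose N := size (words (iota 0 m) m).
pose L h i := nth 0%N (nth [::] (words (iota 0 m) m) h) i.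
have /choice[z zP] : forall uj : W * nat, exists o : option nat,
    ((uj.2 < k)%N -> forall i, (i < m)%N -> uj.1 \in supp (f i) -> o = lbl (f i) uj.1 uj.2) /\
    ((k <= uj.2)%N ->
       (o = None /\ ~ exists a, forall i, (i < m)%N -> uj.1 \in supp (f i) -> L (uj.2 - k)%N i = a)
       \/ (exists2 a, o = Some a & forall i, (i < m)%N -> uj.1 \in supp (f i) -> L (uj.2 - k)%N i = a)).
  move=> [u j] /=; have [jk|kj] := ltnP j k; last first.
    have [[a aP]|h] := pselect (exists a, forall i, (i < m)%N -> u \in supp (f i) -> L (j - k)%N i = a).
      by exists (Some a); split=> // _; right; exists a.
    by exists None; split=> // _; left.
  have [[i [im us]]|h] := pselect (exists i, (i < m)%N /\ u \in supp (f i)); last first.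
    by exists None; split=> // _ i im us; case: h; exists i.
  exists (lbl (f i) u j); split=> // _ i' im' us'.
  have [pr pu] := posP u i im us; have [_ pu'] := posP u i' im' us'.
  by have := lblE i i' (pos u) j im im' pr jk; rewrite pu pu'.
pose zz u j := z (u, j).
pose s := sort <=%O (undup (flatten [seq supp (f i) | i <- iota 0 m])).
have sE u : u \in s <-> exists2 i, (i < m)%N & u \in supp (f i).
  rewrite mem_sort mem_undup; split.
    by move=> /flatten_mapP[i]; rewrite mem_iota => /= im us; exists i.
  by move=> [i im us]; apply/flatten_mapP; exists i; rewrite ?mem_iota.
suff sok : labelled_ok s (k + N) zz.
  exists (Labelled sok) => i im; split=> /=.
  - by move=> u us; apply/sE; exists i.
  - by rewrite lenE // leq_addr.
  - move=> u j us jk; rewrite lenE // in jk; have [h _] := zP (u, j); exact: h.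
  - move=> j u v; rewrite lenE // => kj _ us vs [a [b [/= zu zv ab]]].
    rewrite /zz in zu zv; apply: ab.
    have [_ /(_ kj) /=] := zP (u, j); have [_ /(_ kj) /=] := zP (v, j).
    rewrite zu zv => -[[]//|[b' [<-] bP]] [[]//|[a' [<-] aP]].
    by rewrite -(aP i im us) (bP i im vs).
split; first by rewrite sort_lt_sorted undup_uniq.
move=> X Xs Xc.
have XP u : u \in X -> exists2 i, (i < m)%N & u \in supp (f i) by move=> /Xs/sE.
have [X0|[u0 u0X]] : (X = [::]) \/ (exists u0, u0 \in X).
  by case: (X) => [|u X']; [left|right; exists u; rewrite mem_head].
  by apply: Kher (K1 w0); rewrite X0.
pose meet u v := exists2 i, (i < m)%N & u \in supp (f i) /\ v \in supp (f i).
pose below u v := forall i, (i < m)%N -> v \in supp (f i) -> u \in supp (f i).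
(* If u precedes v in some support, then u is in every support that contains v. *)
have lam u v : meet u v -> (pos u <= pos v)%N -> below u v.
  move=> [i im [us vs]] uv i' im' vs'.
  have [_ pu] := posP u i im us; have [vr pv] := posP v i im vs.
  have [_ pv'] := posP v i' im' vs'.
  have := @Elow i i' (pos v) (pos u) im im' vr uv (etrans pv (esym pv')).
  by rewrite pu => ->; apply: Emem => //; exact: leq_ltn_trans vr.
(* Points of X at the highest position among those they meet; the sets of
   conditions that contain them are disjoint, and everything in X is below one
   of them. *)
pose top v := `[< forall w, w \in X -> meet v w -> (pos w <= pos v)%N >].
pose U := [seq v <- undup X | top v].
have UX v : v \in U -> v \in X by rewrite mem_filter mem_undup => /andP[].
have Udisj u v : u \in U -> v \in U -> meet u v -> u = v.
  rewrite !mem_filter => /andP[/asboolP tu uX] /andP[/asboolP tv vX] uv.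
  rewrite mem_undup in uX; rewrite mem_undup in vX.
  have vu : meet v u by have [i im []] := uv; exists i.
  have [i im [us vs]] := uv.
  have [_ pu] := posP u i im us; have [_ pv] := posP v i im vs.
  by rewrite -pu -pv; congr E; apply/eqP; rewrite eqn_leq tu // tv.
have Ucov u : u \in X -> exists2 v, v \in U & below u v.
  move=> uX.
  have : exists p, `[< exists v, [/\ v \in X, meet u v & pos v = p] >].
    have [i im us] := XP u uX.
    by exists (pos u); apply/asboolP; exists u; split=> //; exists i.
  move=> ex.
  have bnd p : `[< exists v, [/\ v \in X, meet u v & pos v = p] >] -> (p <= r)%N.
    move=> /asboolP[v [_ [i im [_ vs]] <-]].
    by have [/ltnW] := posP v i im vs.
  have [p /asboolP[v [vX uv vp]] pmax] := ex_maxnP ex bnd.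
  have uvp : (pos u <= pos v)%N.
    rewrite vp; apply: pmax; apply/asboolP; exists u; split=> //.
    by have [i im us] := XP u uX; exists i.
  exists v; last exact: lam.
  rewrite mem_filter mem_undup vX andbT; apply/asboolP => w wX [i im [vs ws]].
  rewrite vp; apply: pmax; apply/asboolP; exists w; split=> //.
  by exists i => //; split=> //; exact: (lam u v).
have /choice[ib ibP] : forall v, exists i, v \in U -> (i < m)%N /\ v \in supp (f i).
  move=> v; have [vU|nv] := pselect (v \in U); last by exists 0%N.
  by have [i im vs] := XP v (UX v vU); exists i.
(* The coordinate of the function lab, which sends all conditions containing v in
   U to one of them, ib v, gives distinct labels to the elements of U. *)
have Usize : (size U <= n)%N.
  rewrite leqNgt; apply/negP => nU.
  have /choice[lab labP] : forall i, exists a, (a < m)%N /\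
      forall v, v \in U -> (i < m)%N -> v \in supp (f i) -> a = ib v.
    move=> i; have [[v [vU im vs]]|h] := pselect (exists v, [/\ v \in U, (i < m)%N & v \in supp (f i)]).
      exists (ib v); split; first by have [] := ibP v vU.
      by move=> v' v'U _ vs'; rewrite (Udisj v v') //; exists i.
    by exists 0%N; split=> // v vU im vs; case: h; exists v.
  pose l := mkseq lab m.
  have lw : l \in words (iota 0 m) m.
    rewrite -{2}(size_mkseq lab m); apply: mem_words => a /mapP[i _ ->].
    by rewrite mem_iota; case: (labP i).
  pose h := index l (words (iota 0 m) m).
  have hN : (h < N)%N by rewrite index_mem.
  have LE i : (i < m)%N -> L h i = lab i by move=> im; rewrite /L nth_index // nth_mkseq.
  have zE v : v \in U -> zz v (k + h)%N = Some (ib v).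
    move=> vU; have [_ /(_ (leq_addr _ _))] := zP (v, (k + h)%N).
    rewrite /= addKn => -[[_ []]|[a zv aP]].
      exists (ib v) => i im vs; rewrite LE //; have [_ hh] := labP i; exact: hh.
    rewrite /zz zv; have [im vs] := ibP v vU; rewrite -(aP _ im vs) LE //.
    by have [_ hh] := labP (ib v); rewrite (hh v).
  apply: (Xc (k + h)%N); first by rewrite ltn_add2l.
  exists (nth w0 U); split=> [i iU|i j ij jn] /=.
    by apply: UX; apply: mem_nth; exact: leq_trans nU.
  have jU : (j < size U)%N := leq_trans jn nU.
  have iU : (i < size U)%N := ltn_trans ij jU.
  have mi := mem_nth w0 iU; have mj := mem_nth w0 jU.
  exists (ib (nth w0 U i)), (ib (nth w0 U j)); split; [exact: zE|exact: zE|].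
  move=> eib; have [im us] := ibP _ mi; have [_ vs] := ibP _ mj; rewrite -eib in vs.
  have mt : meet (nth w0 U i) (nth w0 U j) by exists (ib (nth w0 U i)).
  have /eqP := Udisj _ _ mi mj mt.
  by rewrite nth_uniq ?(ltn_eqF ij) // filter_uniq // undup_uniq.
(* All positions of X, as a list of length r: the class records colours of lists
   of that length, so the other entries repeat the position of u0. *)
pose ps := [seq if p \in map pos X then p else pos u0 | p <- iota 0 r].
have psX p : p \in ps -> exists2 u, u \in X & p = pos u.
  move=> /mapP[q _ ->]; case: ifP => [/mapP[u]|_]; first by exists u.
  by exists u0.
have Xr u : u \in X -> (pos u < r)%N.
  by move=> /XP[i im us]; have [] := posP u i im us.
have psr p : p \in ps -> (p < r)%N by move=> /psX[u uX ->]; exact: Xr.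
have Xps u : u \in X -> pos u \in ps.
  move=> uX; apply/mapP; exists (pos u); first by rewrite mem_iota; exact: Xr.
  by rewrite map_f.
have [v0 v0U _] := Ucov u0 u0X.
pose F t := [seq E (ib (nth v0 U t)) p | p <- ps].
have nthU t : nth v0 U t \in U.
  by have [tU|Ut] := ltnP t (size U); [exact: mem_nth|rewrite nth_default].
apply: Kher (Kmerge (f := F) (c := col (F 0%N)) _).
  move=> u uX; have [v vU uv] := Ucov u uX.
  apply/flatten_mapP; exists (index v U).
    by rewrite mem_iota /=; apply: leq_trans Usize; rewrite index_mem.
  have [im vs] := ibP v vU; have us := uv _ im vs.
  apply/mapP; exists (pos u); first exact: Xps.
  by rewrite nth_index //; have [_ ->] := posP u _ im us.
move=> t _; have [im _] := ibP _ (nthU t); have [im0 _] := ibP _ (nthU 0%N).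
split; last first.
  apply: colE => //; first by rewrite size_map size_iota.
  by move=> p /psr; rewrite mem_iota.
have [_ ok] := lblP (f (ib (nth v0 U t))); apply: ok.
  by move=> _ /mapP[p /psr pr ->]; exact: Emem.
move=> j; rewrite lenE // => jk [d [dF dc]]; apply: (Xc j); first by rewrite ltn_addr.
have /choice[g gP] : forall i, exists u, (i < n.+1)%N -> u \in X /\
    zz u j = lbl (f (ib (nth v0 U t))) (d i) j.
  move=> i; have [i_n|_] := ltnP i n.+1; last by exists w0.
  have /mapP[p /psX[u uX pu] du] := dF i i_n.
  exists u => _; split=> //; have [i' im' us'] := XP u uX.
  have [h _] := zP (u, j); rewrite /zz (h jk i' im' us') /=.
  have [pr eu] := posP u i' im' us'.
  by have := lblE i' _ (pos u) j im' im pr jk; rewrite eu du pu.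
(* A clique in the copy comes from a clique in X, labels below k being equal at
   equal positions. *)
exists g; split=> [i /gP[]//|i i' ii' i'n].
have [_ e1] := gP i (ltn_trans ii' i'n); have [_ e2] := gP i' i'n.
by have [a [b [za zb ab]]] := dc i i' ii' i'n; exists a, b; rewrite e1 e2.
Qed.

Context (KH : forall (d : Order.disp_t) (P : porderType d),
  sigma_linked n P -> property_K n.+1 P).

(** Otherwise every condition has an extension whose further extensions have bounded
supports. Start from all singletons; by sigma-centeredness a bound that works
for one representative of each of the countably many classes works for all,
which is absurd for singletons above that bound. *)
Lemma unbounded_condition : exists q0, forall q, refines q q0 -> forall w,
  exists2 q', refines q' q & exists2 u, u \in supp q' & w < u.
Proof.
have [kap kapP] := labelled_sigma_centered.
apply: contrapT => /forallNP h.
have {}h q0 : exists q w, refines q q0 /\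
    forall q', refines q' q -> forall u, u \in supp q' -> u <= w.
  apply: contrapT => h'; apply: (h q0) => q qq0 w; apply: contrapT => hw.
  apply: h'; exists q, w; split=> // q' q'q u us; rewrite leNgt; apply/negP => wu.
  by apply: hw; exists q' => //; exists u.
have sing u : labelled_ok [:: u] 0 (fun _ _ => None).
  by split=> // X Xu _; apply: Kher (K1 u).
have /choice[qx qxP] : forall u, exists p : labelled * W, u \in supp p.1 /\
    forall q', refines q' p.1 -> forall v, v \in supp q' -> v <= p.2.
  move=> u; have [q [w [[sq _ _ _] qP]]] := h (Labelled (sing u)).
  by exists (q, w); split=> //; apply: sq; rewrite mem_head.
have [w0 _] := omega1_inhabited W1.
have /choice[a aP] : forall c, exists u, (exists v, kap (qx v).1 = c) -> kap (qx u).1 = c.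
  by move=> c; have [[v vc]|nv] := pselect (exists v, kap (qx v).1 = c); [exists v|exists w0].
have [|w wP] := @countable_bounded (range (fun c => (qx (a c)).2)).
  exact: sub_countable (card_image_le _ _) (countableP _).
have [_ nW _] := W1; have [u _ wu] := uncountable_unbounded W1 nW w.
set c := kap (qx u).1.
have kac : kap (qx (a c)).1 = c by apply: aP; exists u.
have [|t tP] := kapP (fun i => if i == 0%N then (qx (a c)).1 else (qx u).1) 2 c.
  by case=> [|i] _ /=.
have t0 := tP 0%N isT; have [t1 _ _ _] := tP 1%N isT.
have [us _] := qxP u; have [_ /(_ t t0 u (t1 u us))] := qxP (a c).
rewrite leNgt => /negP; apply; apply: le_lt_trans wu; apply: wP; by exists c.
Qed.

(** Take a generic family below a condition that forces the support to be unbounded.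
Its dense sets also decide, for each finite set a, whether a is contained in the
support of a condition; so finite subsets of the union S of all supports are
contained in single conditions. The generic labels satisfy the assumptions of
[clique_free], and in the set Y so obtained the promises made by the conditions
apply. *)
Lemma uncountable_centered : exists Y : set W, ~ countable Y /\
  forall s : seq W, [set` s] `<=` Y -> K s.
Proof.
have [w0 _] := omega1_inhabited W1.
have [q0 q0P] := unbounded_condition.
have [kap kapP] := labelled_sigma_centered.
pose T := {q | refines q q0}.
pose mk q (h : refines q q0) : T := exist _ q h.
pose D (p : seq W * W) (q : T) := (exists2 u, u \in supp (sval q) & p.2 < u) /\
  ({subset p.1 <= supp (sval q)} \/
   forall q', refines q' (sval q) -> ~ {subset p.1 <= supp q'}).
have tr := refines_trans.
have [|||||||g [gD gc]] := @centered_generic n n_gt0 KH _ W W1 T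
    (fun q' q => refines (sval q') (sval q)) (kap \o sval) (seq W * W)%type D.
- by move=> q; exact: refines_refl.
- by move=> x y z; exact: tr.
- move=> f m c fc; have [m0|m0] := posnP m.
    by exists (mk q0 (refines_refl q0)) => i; rewrite m0.
  have [t tP] := kapP (sval \o f) m c fc.
  by exists (mk t (tr _ _ _ (tP 0%N m0) (svalP (f 0%N)))).
- exact: small_prod (small_seq W1 (small_W W1)) (small_W W1).
- move=> [a w] q q' [[u us wu] h] q'q; have [sq _ _ _] := q'q; split.
    by exists u => //; exact: sq.
  case: h => [h|h]; first by left=> v /h/sq.
  by right=> q2 q2q'; apply: h; exact: (tr _ _ _ q2q' q'q).
- move=> [a w] [q qq0]; have [q1 q1q [u us wu]] := q0P q qq0 w.
  have [[q2 q21 aq]|h] := pselect (exists2 q2, refines q2 q1 & {subset a <= supp q2}).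
    exists (mk q2 (tr _ _ _ q21 (tr _ _ _ q1q qq0))); last exact: (tr _ _ _ q21 q1q).
    by split; [exists u => //=; have [h _ _ _] := q21; exact: h|left].
  exists (mk q1 (tr _ _ _ q1q qq0)) => //; split; first by exists u.
  by right=> q2 q21 aq; apply: h; exists q2.
- exact: mk q0 (refines_refl q0).
pose S : set W := [set u | exists p, u \in supp (sval (g p))].
have nS : ~ countable S.
  apply: (unbounded_uncountable W1) => w; have [[u us wu] _] := gD ([::], w).
  by exists u => //; exists ([::], w).
have Sfin (a : seq W) : [set` a] `<=` S -> exists p, {subset a <= supp (sval (g p))}.
  move=> aS; have [_ [h|h]] := gD (a, w0); first by exists (a, w0).
  have /choice[ix ixP] : forall u, exists p, u \in a -> u \in supp (sval (g p)).
    by move=> u; have [/aS[p ?]|?] := pselect (u \in a); [exists p|exists (a, w0)].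
  have [t tP] := gc ((a, w0) :: map ix a); case: (h (sval t)).
    by apply: tP; rewrite mem_head.
  move=> u ua; have [st _ _ _] := tP (ix u) (mem_behead (s := _ :: _) (map_f ix ua)).
  by apply: st; exact: ixP.
have /choice[Z ZP] : forall ui : W * nat, exists o : option nat,
    (forall p, ui.1 \in supp (sval (g p)) -> (ui.2 < len (sval (g p)))%N ->
      o = lbl (sval (g p)) ui.1 ui.2) /\
    ((exists p, ui.1 \in supp (sval (g p)) /\ (ui.2 < len (sval (g p)))%N) \/ o = None).
  move=> [u i] /=.
  have [[p [us il]]|h] := pselect (exists p, u \in supp (sval (g p)) /\ (i < len (sval (g p)))%N);
    last by exists None; split; [move=> p us il; case: h; exists p|right].
  exists (lbl (sval (g p)) u i); split; last by left; exists p.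
  move=> p' us' il'; have [t tP] := gc [:: p; p'].
  have [|_ _ <- //] := tP p; first by rewrite mem_head.
  by have [|_ _ <- //] := tP p'; first by rewrite !inE eqxx orbT.
have [|||Y [YS nY cY]] := clique_free n_gt0 KH (lab := fun i u => Z (u, i))
    (r := fun i => conflict (fun u i => Z (u, i)) i) nS.
- by move=> j u u' v v' e e' [a [b [h1 h2 ab]]]; exists a, b; rewrite -e -e'.
- by move=> j v [a [b [-> [->]]]].
- move=> u v Su Sv; have [|p pP] := Sfin [:: u; v].
    by move=> x /=; rewrite !inE => /orP[]/eqP->.
  exists (len (sval (g p))) => i pi [a [b [za zb ab]]].
  have [hu [[pu [us ui]]|e]] := ZP (u, i); last by rewrite e in za.
  have [hv [[pv [vs vi]]|e]] := ZP (v, i); last by rewrite e in zb.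
  have [t tP] := gc [:: p; pu; pv].
  have [|_ _ _ cp] := tP p; first by rewrite mem_head.
  have [|_ lu tu _] := tP pu; first by rewrite !inE eqxx orbT.
  have [|_ lv tv _] := tP pv; first by rewrite !inE eqxx !orbT.
  apply: (cp i u v) => //.
  + exact: leq_trans lu.
  + by apply: pP; rewrite mem_head.
  + by apply: pP; rewrite !inE eqxx orbT.
  + by exists a, b; rewrite tu // tv // -(hu pu) // -(hv pv).
exists Y; split=> // X XY; have [|p pP] := Sfin X; first by move=> u /XY/YS.
have [_ ok] := lblP (sval (g p)); apply: ok => // j jl [d [dX dc]].
apply: (cY j); exists d; split=> [i /dX/XY//|i i' ii' i'n].
have [a [b [za zb ab]]] := dc i i' ii' i'n; exists a, b; split=> //.
- have [h _] := ZP (d i, j); rewrite (h p) //; apply: pP; apply: dX; exact: ltn_trans i'n.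
- have [h _] := ZP (d i', j); rewrite (h p) //; apply: pP; exact: dX.
Qed.
End CenteredFamily.

(** * Splitting omega_1 elements into centered pieces *)

Section SigmaCentered.
Context (n : nat) (n_gt0 : (0 < n)%N).
Context (KH : forall (d : Order.disp_t) (P : porderType d),
  sigma_linked n P -> property_K n.+1 P).
Context (dW : Order.disp_t) (W : orderType dW) (W1 : is_omega1 W).
Context (I : eqType) (rk : I -> W) (rkP : forall w, countable [set t | (rk t <= w)%O]).
Local Open Scope order_scope.

(** With all but finitely many exceptions in A. *)
Definition almost_all (A Q : I -> Prop) := exists l : seq I, forall t, A t -> t \notin l -> Q t.

Lemma almost_all_seq (X : eqType) (s : seq X) (A : I -> Prop) (Q : X -> I -> Prop) :
  (forall x, x \in s -> almost_all A (Q x)) ->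
  almost_all A (fun t => forall x, x \in s -> Q x t).
Proof.
elim: s => [|x s ih] h; first by exists [::].
have [|l1 l1P] := ih; first by move=> y ys; apply: h; rewrite inE ys orbT.
have [l2 l2P] := h x (mem_head _ _).
exists (l1 ++ l2) => t At; rewrite mem_cat negb_or => /andP[t1 t2] y.
by rewrite inE => /predU1P[->|]; [exact: l2P|exact: l1P].
Qed.

Lemma almost_allI (A Q1 Q2 : I -> Prop) : almost_all A Q1 -> almost_all A Q2 ->
  almost_all A (fun t => Q1 t /\ Q2 t).
Proof.
move=> [l1 l1P] [l2 l2P]; exists (l1 ++ l2) => t At.
by rewrite mem_cat negb_or => /andP[t1 t2]; split; [exact: l1P|exact: l2P].
Qed.

Lemma almost_all_large (A : I -> Prop) (f : I -> nat) :
  (forall t t', A t -> A t' -> f t = f t' -> t = t') ->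
  forall m, almost_all A (fun t => m <= f t)%N.
Proof.
move=> fi; elim=> [|m [l lP]]; first by exists [::].
have [[t0 [At0 f0]]|h] := pselect (exists t, A t /\ f t = m).
  exists (t0 :: l) => t At; rewrite inE negb_or => /andP[/eqP ne tl].
  have := lP t At tl; rewrite leq_eqVlt => /predU1P[e|//].
  by case: ne; apply: fi => //; rewrite f0.
exists l => t At tl; have := lP t At tl; rewrite leq_eqVlt => /predU1P[e|//].
by case: h; exists t.
Qed.

(** The standard coherent sequence, by recursion on w. Along a cofinal sequence u of
stages below w, the point t follows the function of the first u k above its
rank, raised to at least k; the raising keeps the new function finite-to-one. It
agrees with the function at u K at almost all points of rank at most u K,
because only the first K+1 functions matter there and they have almost
everywhere values at least K. The points of rank w itself are simply enumerated. *)
Lemma coherent_finite_to_one : exists e : W -> I -> nat,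
  (forall w m, almost_all (fun t => rk t <= w) (fun t => m <= e w t)%N) /\
  (forall v w, v <= w -> almost_all (fun t => rk t <= v) (fun t => e v t = e w t)).
Proof.
pose Phi (w : W) (g : W -> I -> nat) (f : I -> nat) :=
  (forall m, almost_all (fun t => rk t <= w) (fun t => m <= f t)%N) /\
  (forall v, v < w -> almost_all (fun t => rk t <= v) (fun t => g v t = f t)).
have [|||e eP] := @wf_choice _ _ W1 _ Phi; last 1 first.
- exists e; split=> [w m|v w]; first by have [] := eP w.
  rewrite le_eqVlt => /predU1P[->|vw]; first by exists [::].
  by have [_] := eP w; exact.
- by move=> w g g' f gg' [h1 h2]; split=> // v vw; rewrite -gg' //; exact: h2.
- move=> w g ih.
  have [nu nuP] := countable_code (rkP w).
  have nul := almost_all_large (A := fun t => rk t <= w) nuP.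
  have [[v0 v0w]|h] := pselect (exists v, v < w); last first.
    by exists nu; split=> // v vw; case: h; exists v.
  have [vs [vsw vsP]] : exists e : nat -> W, (forall i, e i < w) /\
      forall v, v < w -> exists i, e i = v.
    by apply: (@countable_enum _ [set v | v < w] v0) => //; have [_ _] := W1; exact.
  pose u := fix u k := if k is k'.+1 then Order.max (u k') (vs k) else vs 0%N.
  have uw k : u k < w by elim: k => [|k ihk] /=; rewrite ?gt_max ?ihk ?vsw.
  have vsu k : vs k <= u k by case: k => //= k; rewrite le_max lexx orbT.
  have umono k l : (k <= l)%N -> u k <= u l.
    elim: l => [|l ihl]; first by rewrite leqn0 => /eqP->.
    rewrite leq_eqVlt => /predU1P[->//|]; rewrite ltnS => /ihl /le_trans; apply.
    by rewrite /= le_max lexx.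
  have /choice[k kP] : forall t, exists k, rk t < w ->
      rk t <= u k /\ forall l, rk t <= u l -> (k <= l)%N.
    move=> t; have [tw|] := pselect (rk t < w); last by exists 0%N.
    have ex : exists k, rk t <= u k by have [k <-] := vsP _ tw; exists k.
    by case: (ex_minnP ex) => k0 h1 h2; exists k0.
  pose f t := if rk t < w then maxn (k t) (g (u (k t)) t) else nu t.
  have gu v l : v <= u l -> almost_all (fun t => rk t <= v) (fun t => g v t = g (u l) t).
    rewrite le_eqVlt => /predU1P[->|vu]; first by exists [::].
    by have [_] := ih _ (uw l); exact.
  have gl l m : almost_all (fun t => rk t <= u l) (fun t => m <= g (u l) t)%N.
    by have [] := ih _ (uw l).
  exists f; split=> [m|v vw].
    have h : almost_all (fun t => rk t <= w) (fun t => forall l, l \in iota 0 m ->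
        rk t <= u l -> (m <= g (u l) t)%N).
      apply: almost_all_seq => l _; have [s sP] := gl l m.
      by exists s => t _ ts tl; exact: sP.
    have [l lP] := almost_allI (nul m) h.
    exists l => t tw tl; have [h1 h2] := lP t tw tl; rewrite /f.
    case: ifP => // tw'; have [tu _] := kP t tw'; rewrite leq_max.
    have [//|km] := leqP m (k t); apply: h2 => //; by rewrite mem_iota.
  have [K KE] := vsP v vw; have vK : v <= u K by rewrite -KE.
  have h : almost_all (fun t => rk t <= v) (fun t => forall l, l \in iota 0 K.+1 ->
      rk t <= u l -> (K <= g (u l) t)%N /\ g (u l) t = g (u K) t).
    apply: almost_all_seq => l; rewrite mem_iota /= ltnS => lK.
    have gK : almost_all (fun t => rk t <= u l) (fun t => g (u l) t = g (u K) t).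
      by apply: gu; exact: umono.
    have [s sP] := almost_allI (gl l K) gK.
    by exists s => t _ ts tl; exact: sP.
  have [l lP] := almost_allI (gu v K vK) h.
  exists l => t tv tl; have [-> {}h] := lP t tv tl.
  have tw := le_lt_trans tv vw; rewrite /f tw.
  have [tu /(_ K (le_trans tv vK)) kK] := kP t tw.
  have [|Kg eg] := h (k t) _ tu; first by rewrite mem_iota.
  by rewrite -eg; apply/esym/maxn_idPr; exact: leq_trans Kg.
- exact: (inhabits (fun=> 0%N)).
Qed.

(** The label of t at stage w consists of the value [e w t] of a coherent
finite-to-one function, the piece of t, and a prefix of a real attached to t
that is long enough to separate t from the finitely many points with the same
value. Prefixes of length at least h are long enough at almost all values, with
h the same for all stages. So at a finite set F of stages, the labels of large
value that occur belong to one point each, and the remaining labels are finitely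
many: the colour of F lists them together with the pieces of lower bounds for
them. For n finite sets of stages of the same colour, each label then has at
most n points or lower bounds to be put together, all from the same piece. *)
Lemma small_sigma_centered (T : Type) (R : T -> T -> Prop) (p0 : T) (pc : T -> nat)
    (ev : I -> T) :
  (forall t, R t t) -> (forall x y z, R x y -> R y z -> R x z) ->
  (forall (f : nat -> T) c, (forall i, (i < n)%N -> pc (f i) = c) ->
     exists p, forall i, (i < n)%N -> R p (f i)) ->
  exists kap : I -> nat, forall (s : seq I) c, (forall t, t \in s -> kap t = c) ->
    exists p, forall t, t \in s -> R p (ev t).
Proof.
move=> Rr Rt lk.
have [e [efin ecoh]] := coherent_finite_to_one.
have [x xinj] := distinct_reals W1.
have [w0 _] := omega1_inhabited W1.
have /choice[nu nuP] : forall w, exists f : I -> nat,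
    forall t t', rk t <= w -> rk t' <= w -> f t = f t' -> t = t'.
  by move=> w; exact: countable_code (rkP w).
pose xI t i := if i is j.+1 then x (rk t) j else nu (rk t) t.
have xIinj : injective xI.
  move=> t t' E; have rE : rk t = rk t'.
    apply: xinj; apply: functional_extensionality_dep => j.
    exact: (congr1 (fun f => f j.+1) E).
  apply: (nuP (rk t)) => //; first by rewrite rE.
  by rewrite (congr1 (fun f => f 0%N) E : nu (rk t) t = nu (rk t') t') rE.
have /choice[bl blP] : forall wm : W * nat, exists l : seq I,
    forall t, rk t <= wm.1 -> (e wm.1 t < wm.2)%N -> t \in l.
  move=> [w m]; have [l lP] := efin w m; exists l => t tw.
  by apply: contraTT => /(lP t tw); rewrite -leqNgt.
have /choice[hh hhP] : forall wi : W * nat, exists l0, forall l, (l0 <= l)%N ->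
    forall t t', rk t <= wi.1 -> rk t' <= wi.1 -> e wi.1 t = wi.2 -> e wi.1 t' = wi.2 ->
    mkseq (xI t) l = mkseq (xI t') l -> t = t'.
  move=> [w i] /=; pose s := bl (w, i.+1).
  have [|l0 lP] := @for_large_seq _ s
      (fun t l => forall t', t' \in s -> mkseq (xI t) l = mkseq (xI t') l -> t = t').
    move=> t ts; apply: for_large_seq => t' t's.
    have [->|ne] := pselect (t = t'); first by exists 0%N.
    have /existsNP[j xj] : ~ forall j, xI t j = xI t' j.
      by move=> h; apply: ne; apply: xIinj; apply: functional_extensionality_dep.
    by exists j.+1 => l jl /mkseq_eq h; case: xj; exact: h.
  exists l0 => l /lP h t t' tw t'w et et'; apply: h; apply: blP => //=.
    by rewrite et.
  by rewrite et'.
have [h hP] := dominate_small n_gt0 KH W1 (fun w i => hh (w, i)) (small_W W1).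
pose lw w i := maxn (h i) (hh (w, i)).
pose label w t := (e w t, pc (ev t), mkseq (xI t) (lw w (e w t))).
pose X (F : seq W) (a : nat * nat * seq nat) t :=
  exists2 w, w \in F & rk t <= w /\ label w t = a.
pose K F := forall a, exists p, forall t, X F a t -> R p (ev t).
have single (F : seq W) a : (forall t t', X F a t -> X F a t' -> t = t') ->
    exists p, forall t, X F a t -> R p (ev t).
  move=> u; have [[t0 Xt0]|nX] := pselect (exists t, X F a t); last first.
    by exists p0 => t Xt; case: nX; exists t.
  by exists (ev t0) => t Xt; rewrite (u t t0).
have /choice[kF kFP] : forall F : seq W, exists k, forall a, (k <= a.1.1)%N ->
    forall t t', X F a t -> X F a t' -> t = t'.
  move=> F; pose u := \big[Order.max/w0]_(w <- F) w.
  have Fu w : w \in F -> w <= u.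
    rewrite /u; elim: (F) => // v l ih; rewrite inE big_cons le_max.
    by move=> /predU1P[->|/ih->]; rewrite ?lexx ?orbT.
  have Fev : for_large (fun i => forall w, w \in F ->
      forall t, rk t <= w -> e w t = i -> e u t = i).
    apply: for_large_seq => w /Fu wu; have [l lP] := ecoh w u wu.
    exists (\max_(t <- l) e w t).+1%N => i li t tw et.
    have [tl|/(lP t tw) <- //] := boolP (t \in l).
    have := @leq_bigmax_seq _ _ xpredT (e w) _ tl isT; rewrite et => il.
    by move: (leq_trans li il); rewrite ltnn.
  have Fh : for_large (fun i => forall w, w \in u :: F -> (hh (w, i) <= h i)%N).
    by apply: for_large_seq => w _; exact: hP.
  have [k kP] := for_largeI Fev Fh; exists k => -[[i b] a] /= /kP[Ev Hh] t t'.
  have lwE w : w \in F -> lw w i = h i.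
    by move=> wF; apply/maxn_idPl; apply: Hh; rewrite inE wF orbT.
  move=> [w wF [tw [et _]]]; rewrite et lwE // => ta.
  move=> [w' w'F [t'w' [et' _]]]; rewrite et' lwE // => t'a.
  apply: (hhP (u, i) (h i)) => /=.
  - by apply: Hh; rewrite mem_head.
  - exact: le_trans (Fu w wF).
  - exact: le_trans (Fu w' w'F).
  - exact: Ev et.
  - exact: Ev et'.
  - by rewrite ta t'a.
have /choice[q qP] : forall Fa : seq W * (nat * nat * seq nat), exists p,
    K Fa.1 -> forall t, X Fa.1 Fa.2 t -> R p (ev t).
  move=> [F a]; have [KF|nK] := pselect (K F); last by exists p0.
  by have [p pP] := KF a; exists p.
pose labels F := [seq label w t | w <- F, t <- bl (w, kF F)].
have labelsP F a t : X F a t -> (a.1.1 < kF F)%N -> a \in labels F.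
  move=> [w wF [tw <-]] /= ak; apply/allpairsPdep; exists w, t; split=> //.
  exact: blP.
pose col F := choice.pickle (kF F, [seq (a, pc (q (F, a))) | a <- labels F]).
have [|||Y [nY YK]] := @uncountable_centered n n_gt0 _ W W1 K _ _ col _ KH.
- move=> s t ts Ks a; have [p pP] := Ks a; exists p => u [w wt h1].
  by apply: pP; exists w => //; exact: ts.
- move=> w a; apply: single => t t' [v]; rewrite inE => /eqP-> [tw ta].
  move=> [v']; rewrite inE => /eqP-> [t'w t'a].
  move: ta; rewrite -t'a => -[et _]; rewrite et => ex.
  by apply: (hhP (w, e w t') (lw w (e w t'))) => //=; rewrite leq_maxr.
- move=> f c fc a.
  have Kf i : (i < n)%N -> K (f i) by move=> /fc[].
  have colE i : (i < n)%N -> col (f i) = col (f 0%N).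
    by move=> i_n; rewrite (fc i i_n).2 (fc 0%N n_gt0).2.
  have kE i : (i < n)%N -> kF (f i) = kF (f 0%N).
    by move=> /colE/(pcan_inj choice.pickleK)[].
  pose G := flatten [seq f i | i <- iota 0 n].
  have XG t : X G a t -> exists2 i, (i < n)%N & X (f i) a t.
    move=> [w /flatten_mapP[i]]; rewrite mem_iota => /= i_n wi tw.
    by exists i => //; exists w.
  have [[t0 Xt0]|nX] := pselect (exists t, X G a t); last first.
    by exists p0 => t Xt; case: nX; exists t.
  have [i0 i0n Xi0] := XG t0 Xt0.
  have [ak|ka] := ltnP a.1.1 (kF (f 0%N)).
    have [|p pP] := lk (fun i => q (f i, a)) (pc (q (f i0, a))).
      move=> i i_n; have /(pcan_inj choice.pickleK)[_ lE] := etrans (colE i0 i0n) (esym (colE i i_n)).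
      have : (a, pc (q (f i0, a))) \in [seq (a, pc (q (f i, a))) | a <- labels (f i)].
        rewrite -lE; apply: map_f; apply: labelsP Xi0 _; by rewrite kE.
      by move=> /mapP[b _ [<- ->]].
    exists p => t /XG[i i_n Xi]; apply: (Rt _ _ _ (pP i i_n)).
    exact: (qP (f i, a) (Kf i i_n)).
  have /choice[g gP] : forall i, exists t, X G a t /\ (forall t', (i < n)%N -> X (f i) a t' -> t' = t).
    move=> i; have [i_n|_] := ltnP i n; last by exists t0.
    have [[t Xt]|nX] := pselect (exists t, X (f i) a t); last first.
      by exists t0; split=> // t' _ Xt'; case: nX; exists t'.
    exists t; split; last by move=> t' _ Xt'; apply: kFP Xt' Xt; rewrite kE.
    have [w wi tw] := Xt; exists w => //; apply/flatten_mapP; exists i => //.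
    by rewrite mem_iota.
  have [|p pP] := lk (fun i => ev (g i)) a.1.2.
    by move=> i _; have [[w _ [_ <-]] _] := gP i.
  exists p => t /XG[i i_n Xi]; have [_ h1] := gP i.
  by rewrite (h1 t i_n Xi); exact: pP.
have /choice[wt wtP] : forall t, exists w, Y w /\ rk t <= w.
  by move=> t; have [w Yw /ltW tw] := uncountable_unbounded W1 nY (rk t); exists w.
(* The stages in Y at which the points are labelled may differ from point to
   point: this is why K speaks of the points with a given label at any stage of
   F. *)
exists (fun t => choice.pickle (label (wt t) t)) => -[|t0 s] c sc; first by exists p0.
have [|p pP] := YK (map wt (t0 :: s)) _ (label (wt t0) t0).
  by move=> w /mapP[t _ ->]; have [] := wtP t.
exists p => t ts; apply: pP; exists (wt t); first exact: map_f.
split; first by have [] := wtP t.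
by apply: (pcan_inj choice.pickleK); rewrite !sc // mem_head.
Qed.
End SigmaCentered.

(** * Martin's axiom *)

Section Generic.
Context (n : nat) (n_gt0 : (0 < n)%N).
Context (KH : forall (d : Order.disp_t) (P : porderType d),
  sigma_linked n P -> property_K n.+1 P).
Context (dW : Order.disp_t) (W : orderType dW) (W1 : is_omega1 W).
Context (d : Order.disp_t) (P : porderType d) (p0 : P) (Psl : sigma_linked n P).
Local Open Scope order_scope.

Definition incompatible (p q : P) := ~ exists r, r <= p /\ r <= q.

(** Only omega_1 elements of P matter, namely those obtained from p0 by lower bounds
of finite lists, by extensions into the given dense sets, and by deciding a
pair: the extension r of a condition is below both p and q, or incompatible with
one of them. Terms for these operations are trees over W; their values split
into countably many centered pieces, and a generic centered family of them
decides all pairs. Since its members are compatible, any two of them have a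
lower bound in the family, so that the family generates a filter. *)
Lemma generic_filter (Dw : W -> set P) : (forall w, downward_cofinal (Dw w)) ->
  exists2 G : set P, poset_filter G & forall w, (G `&` Dw w) !=set0.
Proof.
move=> Dcof.
have [pc pcP] := sigma_linked_pieces n_gt0 Psl.
have /choice[lbs lbsP] : forall s : seq P, exists p, (exists q, forall x, x \in s -> q <= x) ->
    forall x, x \in s -> p <= x.
  by move=> s; have [[q qs]|h] := pselect (exists q, forall x, x \in s -> q <= x);
    [exists q|exists p0].
have /choice[meetD meetDP] : forall wp : W * P, exists q, Dw wp.1 q /\ q <= wp.2.
  by move=> [w p]; have [q] := Dcof w p; exists q.
pose decided (p q r : P) := (r <= p /\ r <= q) \/ incompatible r p \/ incompatible r q.
have /choice[dec decP] : forall t : P * P * P, exists r, r <= t.2 /\ decided t.1.1 t.1.2 r.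
  move=> [[p q] r] /=.
  have [[r1 [r1r r1p]]|h] := pselect (exists r1, r1 <= r /\ r1 <= p); last first.
    by exists r; split=> //; right; left.
  have [[r2 [r21 r2q]]|h] := pselect (exists r2, r2 <= r1 /\ r2 <= q); last first.
    by exists r1; split=> //; right; right.
  exists r2; split; first exact: le_trans r1r.
  by left; split=> //; exact: le_trans r1p.
pose I := GenTree.tree W.
pose ev := fix ev (t : I) : P := match t with
  | GenTree.Leaf w => p0
  | GenTree.Node 0 ts => lbs (map ev ts)
  | GenTree.Node 1 [:: GenTree.Leaf w; t] => meetD (w, ev t)
  | GenTree.Node 2 [:: a; b; c] => dec (ev a, ev b, ev c)
  | _ => p0 end.
have sI : small W I := small_tree W1 (small_W W1).
have [rk rkP] := sI.
have lt := @le_trans d P.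
have [|||kap kapP] := @small_sigma_centered n n_gt0 KH dW W W1 I rk rkP P
  (fun x y => x <= y) p0 pc ev.
- by [].
- by move=> x y z; exact: lt.
- exact: pcP.
pose D (j : W + I * I) (t : I) : Prop := match j with
  | inl w => exists2 p, Dw w p & ev t <= p
  | inr (a, b) => decided (ev a) (ev b) (ev t) end.
have [|||||||g [gD gc]] := @centered_generic n n_gt0 KH _ W W1 I (fun t t' => ev t <= ev t')
    kap (W + I * I)%type D.
- by [].
- by move=> x y z; exact: lt.
- move=> f m c fc; pose s := [seq f i | i <- iota 0 m].
  have [|p pP] := kapP s c.
    by move=> t /mapP[i]; rewrite mem_iota => /= im ->; exact: fc.
  exists (GenTree.Node 0 s) => i im; apply: (lbsP (map ev s)).
    by exists p => x /mapP[t ts ->]; exact: pP.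
  by apply: map_f; apply: map_f; rewrite mem_iota.
- exact: small_sum (small_W W1) (small_prod sI sI).
- move=> [w|[a b]] t t' /=; first by move=> [p Dp tp] t't; exists p => //; exact: lt tp.
  have inc x : incompatible (ev t) x -> ev t' <= ev t -> incompatible (ev t') x.
    by move=> h t't [r [rt rx]]; apply: h; exists r; split=> //; exact: lt t't.
  move=> [[ta tb]|[h|h]] t't.
  + by left; split; exact: lt t't _.
  + by right; left; exact: inc h t't.
  + by right; right; exact: inc h t't.
- move=> [w|[a b]] t /=.
    exists (GenTree.Node 1 [:: GenTree.Leaf w; t]) => /=.
      by exists (meetD (w, ev t)) => //; case: (meetDP (w, ev t)).
    by case: (meetDP (w, ev t)).
  by exists (GenTree.Node 2 [:: a; b; t]) => /=; case: (decP (ev a, ev b, ev t)).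
- exact: GenTree.Node 0 [::].
pose G : set P := [set p | exists j, ev (g j) <= p].
have compat (j k l : W + I * I) : exists r, [/\ r <= ev (g j), r <= ev (g k) & r <= ev (g l)].
  have [t tP] := gc [:: j; k; l].
  by exists (ev t); split; apply: tP; rewrite !inE eqxx ?orbT.
have dir j k : exists l, ev (g l) <= ev (g j) /\ ev (g l) <= ev (g k).
  exists (inr (g j, g k)); have [[h1 h2]//|[h|h]] := gD (inr (g j, g k)).
  - by case: h; have [r [r1 r2 _]] := compat (inr (g j, g k)) j j; exists r.
  - by case: h; have [r [r1 r2 _]] := compat (inr (g j, g k)) k k; exists r.
have [w0 _] := omega1_inhabited W1.
have seqdir (s : seq P) : [set` s] `<=` G -> exists j, forall p, p \in s -> ev (g j) <= p.
  elim: s => [|p s ih] sG; first by exists (inl w0).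
  have [j jp] : G p by apply: sG; rewrite /= mem_head.
  have [|k ks] := ih; first by move=> q qs; apply: sG; rewrite /= inE qs orbT.
  have [l [lj lk]] := dir j k; exists l => q; rewrite inE => /predU1P[->|/ks]; first exact: lt jp.
  exact: lt.
exists G; last first.
  by move=> w; have [p Dp gp] := gD (inl w); exists p; split=> //; exists (inl w).
split; first by move=> p q [j jp] pq; exists j; exact: lt pq.
move=> A AG /finite_fsetP[X AX]; have [|j jP] := seqdir (enum_fset X).
  by move=> p pX; apply: AG; rewrite AX.
exists (ev (g j)); split; first by exists j.
by move=> p; rewrite AX => /jP.
Qed.
End Generic.

Theorem theorem3 (n : nat) (hn : (2 <= n)%N) :
  (forall (d : Order.disp_t) (P : porderType d),
     sigma_linked n P -> property_K n.+1 P) ->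
  MA_omega1 (fun d P => @sigma_linked n d P).
Proof.
move=> KH d P [p0 _] Psl dW W W1 X XW Xcof.
have [w0 _] := omega1_inhabited W1.
pose pW : pointedType := HB.pack W (Choice.class W) (isPointed.Build W w0).
have /(@pcard_injP _ pW)[f fi] := XW.
have /choice[Dw DwP] : forall w, exists D : set P, downward_cofinal D /\
    forall D', X D' -> f D' = w -> D' = D.
  move=> w; have [[D [XD fD]]|h] := pselect (exists D, X D /\ f D = w).
    exists D; split=> [|D' XD' fD']; first exact: Xcof.
    by apply: fi; rewrite ?inE // fD fD'.
  exists setT; split=> [p|D XD fD]; first by exists p.
  by case: h; exists D.
have [w|G Gf GD] := @generic_filter n (ltnW hn) KH dW W W1 d P p0 Psl Dw.
  by case: (DwP w).
by exists G => // D XD; have [_ /(_ D XD erefl) ->] := DwP (f D).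
Qed.
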